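(* Let $\Gamma$ be a countable discrete group with a non-singular Borel action on a standard Borel probability space $(X,\mu)$. Then the transformation groupoid $(\Gamma\ltimes X,\mu)$ is Choquet--Deny if and only if $\Gamma$ is Choquet--Deny and the action $\Gamma\curvearrowright X$ has finite orbits $\mu$-almost everywhere.
   Context: The transformation groupoid $\mathcal{G}=\Gamma\ltimes X$ is the set $\Gamma\times X$ with unit space $X$ (identified with $\{e\}\times X$), $s(g,x)=x$, $t(g,x)=g\cdot x$, and product $(g,h\cdot x)(h,x)=(gh,x)$. Non-singular means each group element preserves the class of $\mu$-null sets. Put $\mathcal{G}^x=t^{-1}(x)=\{(g,g^{-1}x):g\in\Gamma\}$. Markov operators. An invariant Markov operator $P$ on $\mathcal{G}$ is given by probability measures $d_xP$ on $\mathcal{G}^x$ ($x\in X$) such that for each non-negative Borel function $f$ on $\mathcal{G}$ the map $g\mapsto\sum_{h\in\mathcal{G}^{s(g)}}d_{s(g)}P(h)f(gh)$ is Borel. For each $x$, $P_x$ acts on $\ell^\infty(\mathcal{G}^x)$ by $P_xf(g)=\sum_{h\in\mathcal{G}^{s(g)}}d_{s(g)}P(h)f(gh)$. Powers $P^n$ ($n\ge1$) correspond to $d_xP^n(g)=\sum_{h\in\mathcal{G}^x}d_xP(h)\,d_{s(h)}P^{n-1}(h^{-1}g)$ (with $P^1=P$ for $n=1$). $P$ is non-degenerate if $\bigcup_{n\ge1}\{g\in\mathcal{G}^x:d_xP^n(g)>0\}=\mathcal{G}^x$ for all $x\in X$. $P_x$ is Liouville if every $f\in\ell^\infty(\mathcal{G}^x)$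 with $P_xf=f$ is constant; $P$ is fiberwise Liouville if $P_x$ is Liouville for $\mu$-almost every $x$. $(\mathcal{G},\mu)$ is Choquet--Deny if every non-degenerate invariant Markov operator on it is fiberwise Liouville. Groups. A countable discrete group $\Gamma$ is Choquet--Deny if for every probability measure $\nu$ on $\Gamma$ whose support generates $\Gamma$ as a semigroup, every bounded $f:\Gamma\to\mathbb{C}$ with $f(g)=\sum_{h\in\Gamma}\nu(h)f(gh)$ for all $g$ is constant. *)

(* Defs.v *)
From HB Require Import structures.
From mathcomp Require Import all_boot all_order all_algebra.
From mathcomp Require Import all_classical all_reals all_analysis.
From mathcomp Require Import measurable_realfun complex.

Set Implicit Arguments.
Unset Strict Implicit.
Unset Printing Implicit Defensive.

Import Order.TTheory GRing.Theory Num.Theory.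

Local Open Scope classical_set_scope.
Local Open Scope ring_scope.
Local Open Scope complex_scope.

(* A copy of the group [G] carrying the sigma-algebra of all subsets, so that
   the Borel structure of [G * X] is that of the product type
   [discrete G * X]. *)
Definition discrete (G : groupType) : Type := G.

HB.instance Definition _ (G : groupType) := Group.on (discrete G).
HB.instance Definition _ (G : groupType) :=
  isPointed.Build (discrete G) (1%g : G).
HB.instance Definition _ (G : groupType) :=
  @isMeasurable.Build default_measure_display (discrete G)
    (@discrete_measurable (discrete G))
    (@discrete_measurable0 (discrete G)) (@discrete_measurableC (discrete G))
    (@discrete_measurableU (discrete G)).

Section sums.
Context {R : realType} {T : choiceType}.
Implicit Type A : set T.

(* The sums below are only used for absolutely summable families; the sum is
   that of the positive parts minus that of the negative parts. *)
Definition rsum A (a : T -> R) : R :=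
  let b t := (a t)%:E in
  fine (\esum_(t in A) (b^\+)%E t) - fine (\esum_(t in A) (b^\-)%E t).

Definition csum A (a : T -> R[i]) : R[i] :=
  rsum A (fun t => complex.Re (a t)) +i* rsum A (fun t => complex.Im (a t)).

(* Probability measures on a countable discrete set [A], given by their mass
   functions; values outside [A] are irrelevant. *)
Definition prob_mass A (p : T -> R) : Prop :=
  (forall t, A t -> 0 <= p t) /\ \esum_(t in A) (p t)%:E = 1%E.

Definition bounded_on A (f : T -> R[i]) : Prop :=
  exists M : R, forall t, A t -> `|f t| <= M%:C.

Definition constant_on A (f : T -> R[i]) : Prop :=
  exists c : R[i], forall t, A t -> f t = c.

End sums.

Section groups.
Variables (R : realType) (G : groupType).

Definition generated_semigroup (S : set G) : set G :=
  smallest [set M : set G | forall g h, M g -> M h -> M (g * h)%g] S.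

Definition group_choquet_deny : Prop :=
  forall nu : G -> R, prob_mass [set: G] nu ->
    generated_semigroup [set g | 0 < nu g] = [set: G] ->
  forall f : G -> R[i], bounded_on [set: G] f ->
    (forall g, f g = csum [set: G] (fun h => (nu h)%:C * f (g * h)%g)) ->
  constant_on [set: G] f.

End groups.

Section standard_borel.
Variables (R : realType) (d : measure_display) (X : measurableType d).

(* [X] is Borel isomorphic to a complete separable metric space. *)
Definition standard_borel : Prop :=
  exists T : metricType R,
  [/\ forall u : nat -> T, cauchy (u @ \oo) -> exists l : T, u @ \oo --> l,
      exists2 D : set T, countable D & dense D
    & exists2 f : X -> T, bijective f &
        forall A : set X, measurable A <-> <<s @open T >> (f @` A)].

End standard_borel.

Section actions.
Variables (R : realType) (G : groupType).
Variables (d : measure_display) (X : measurableType d).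
Variables (mu : set X -> \bar R) (act : G -> X -> X).

Definition is_action : Prop :=
  (forall x, act 1%g x = x) /\
  (forall g h x, act (g * h)%g x = act g (act h x)).

Definition borel_action : Prop :=
  measurable_fun [set: discrete G * X] (fun p : discrete G * X => act p.1 p.2).

Definition nonsingular : Prop :=
  forall (g : G) (A : set X), measurable A -> mu (act g @` A) = 0%E <-> mu A = 0%E.

Definition orbit_of (x : X) : set X := range (act^~ x).

Definition ae_finite_orbits : Prop :=
  {ae mu, forall x, finite_set (orbit_of x)}.

End actions.

Section transformation_groupoid.
Variables (R : realType) (G : groupType).
Variables (d : measure_display) (X : measurableType d).
Variables (mu : set X -> \bar R) (act : G -> X -> X).

Local Notation groupoid := (discrete G * X)%type.

Definition source (a : groupoid) : X := a.2.
Definition target (a : groupoid) : X := act a.1 a.2.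

(* The product of [a] and [b] is only meaningful if [source a = target b]. *)
Definition gpd_mul (a b : groupoid) : groupoid := ((a.1 * b.1)%g, b.2).
Definition gpd_inv (a : groupoid) : groupoid := ((a.1^-1)%g, act a.1 a.2).

Definition fiber (x : X) : set groupoid := [set a | target a = x].

(* [P x h] is the mass that the measure [d_x P] on [fiber x] gives to [h]. *)
Implicit Type P : X -> groupoid -> R.

Definition invariant_markov P : Prop :=
  (forall x, prob_mass (fiber x) (P x)) /\
  (forall f : groupoid -> R, measurable_fun [set: groupoid] f ->
    (forall a, 0 <= f a) ->
    measurable_fun [set: groupoid] (fun g : groupoid =>
      \esum_(h in fiber (source g))
         (P (source g) h * f (gpd_mul g h))%:E : \bar R)).

Definition markov_op P (f : groupoid -> R[i]) (g : groupoid) : R[i] :=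
  csum (fiber (source g))
       (fun h => (P (source g) h)%:C * f (gpd_mul g h)).

(* [markov_pow P n] is the mass function of the power [P^(n+1)]. *)
Fixpoint markov_pow P (n : nat) (x : X) (g : groupoid) : \bar R :=
  if n is m.+1 then
    (\esum_(h in fiber x)
       ((P x h)%:E * markov_pow P m (source h) (gpd_mul (gpd_inv h) g)))%E
  else (P x g)%:E.

Definition nondegenerate P : Prop :=
  forall x, \bigcup_n [set g | fiber x g /\ (0 < markov_pow P n x g)%E]
            = fiber x.

Definition liouville P (x : X) : Prop :=
  forall f : groupoid -> R[i], bounded_on (fiber x) f ->
    (forall g, fiber x g -> markov_op P f g = f g) ->
  constant_on (fiber x) f.

Definition fiberwise_liouville P : Prop :=
  {ae mu, forall x, liouville P x}.

Definition groupoid_choquet_deny : Prop :=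
  forall P, invariant_markov P -> nondegenerate P -> fiberwise_liouville P.

End transformation_groupoid.

(* Main.v *)
Require Import Defs.
From mathcomp Require Import all_boot all_order all_algebra.
From mathcomp Require Import all_classical all_reals all_analysis.
From mathcomp Require Import measurable_realfun complex ring lra zify.

(* Finite orbits.  If Gamma is Choquet--Deny, it has no proper normal subgroup N
   such that Gamma / N is ICC: otherwise Neumann's lemma provides switching
   elements, and, as in the theorem of Frisch, Hartman, Tamuz and Vahidi
   Ferdowsi, a heavy-tailed measure whose letters at each new record are
   switching elements gives a walk that remembers its starting point modulo N.
   Let H0 be the kernel of the action on a finite orbit.  The elements of H0 that
   leave every bounded harmonic function invariant form a normal subgroup K such
   that the elements of H0 with finitely many conjugates modulo K lie in K; as
   the upper FC-series of Gamma is exhaustive, K = H0, so that a harmonic function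
   lives on the finite set Gamma / H0 and the maximum principle applies.

   Infinite orbits.  Markers split every infinite orbit into levels
   A_0, A_1, ... and a point of A_n jumps to A_{n+2} except with probability
   2^-(n+1).  The eventual parity of the level is then random, and its law is a
   nonconstant harmonic function. *)

(** Along an orbit the step law varies from point to point, whereas the Choquet--Deny property of
    Gamma speaks of a single measure. On finite orbits it therefore enters only through the upper
    FC-series, an algebraic statement that holds for all step laws at once. Conversely, Gamma
    inherits the property from the groupoid by putting the same measure on all fibres.

    Both non-constant harmonic functions are obtained without a path space. Explicit lower bounds
    [u] and [v] for the probabilities of two incompatible fates of the walk are subharmonic with
    [u + v <= 1], and a harmonic function is squeezed between [u] and [1 - v]. The work lies in
    finding bounds that do not decrease on average; this dictates the loss 4 / (j + 16) at level j
    in the group and the loss 2^-n at level n of an infinite orbit. *)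

Set Implicit Arguments.
Unset Strict Implicit.
Unset Printing Implicit Defensive.

Import Order.TTheory GRing.Theory Num.Theory numFieldNormedType.Exports.

Local Open Scope classical_set_scope.

(** * Normal subgroups and finite conjugacy classes *)

Section fc_classes.
Variable G : groupType.
Implicit Types (N K L : set G) (g h k s t x y : G).

Lemma mulgAV x y z : ((x * y) * z = x * (y * z))%g.
Proof. by rewrite mulgA. Qed.

(* As left-to-right rewrite rules these decide equality in free groups. *)
Definition gnorm := (mulgAV, @invgM G, @invgK G, @mul1g G, @mulg1 G,
  @mulVg G, @mulgV G, @mulKg G, @mulVKg G, @invg1 G).

Definition normal_subgroup N : Prop :=
  [/\ N 1%g, forall x y, N x -> N y -> N (x^-1 * y)%g
    & forall g x, N x -> N (g * x * g^-1)%g].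

Lemma nsub1 N : normal_subgroup N -> N 1%g. Proof. by case. Qed.

Lemma nsubV N x : normal_subgroup N -> N x -> N (x^-1)%g.
Proof. by move=> [N1 Nd _] Nx; rewrite -[(x^-1)%g]mulg1; exact: Nd. Qed.

Lemma nsubM N x y : normal_subgroup N -> N x -> N y -> N (x * y)%g.
Proof.
move=> nN Nx Ny; have [N1 Nd _] := nN.
by rewrite -[x]invgK; apply: Nd => //; exact: nsubV.
Qed.

Lemma nsubJ N g x : normal_subgroup N -> N x -> N (g * x * g^-1)%g.
Proof. by case=> _ _; exact. Qed.

Lemma nsubJV N g x : normal_subgroup N -> N x -> N (g^-1 * x * g)%g.
Proof. by move=> nN Nx; rewrite -{2}[g]invgK; exact: nsubJ. Qed.

(* [x] has finitely many conjugates modulo [N]: a finite colouring of the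
   conjugating elements determines the conjugate. *)
Definition fc_mod N x : Prop :=
  exists (T : finType) (D : G -> T), forall s t, D s = D t ->
    N ((s * x * s^-1)^-1 * (t * x * t^-1))%g.

Definition fc_closed N : Prop := forall x, fc_mod N x -> N x.

Lemma neumann (I : eqType) (H : I -> set G) (Hs : seq I) (A : seq G) :
  (forall i x y, H i x -> H i y -> H i (x^-1 * y)%g) ->
  (forall g, exists i a, [/\ i \in Hs, a \in A & H i (a^-1 * g)%g]) ->
  exists i, i \in Hs /\
    exists B : seq G, forall g, exists2 b, b \in B & H i (b^-1 * g)%g.
Proof.
move=> Hd; elim: Hs A => [|i Hs IH] A cov.
  by have [i [a []]] := cov 1%g.
have [[c cN]|all_c] := pselect (exists c, forall a, a \in A -> ~ H i (a^-1 * c)%g).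
  have := IH (A ++ [seq (a * c^-1 * b)%g | a <- A, b <- A]).
  case=> [g|j [jH jfin]]; last by exists j; rewrite inE jH orbT.
  have [j [a [+ aA Hj]]] := cov g.
  rewrite inE => /orP[/eqP ji|jH]; last first.
    by exists j, a; rewrite mem_cat aA.
  subst j; have [j [b [+ bA Hb]]] := cov (c * a^-1 * g)%g.
  rewrite inE => /orP[/eqP ji|jH].
    subst j; exfalso; apply: (cN b bA).
    have := Hd _ _ _ Hj (Hd _ _ _ Hb Hj).
    have Hv x : H i x -> H i (x^-1)%g.
      by move=> Hx; rewrite -[(x^-1)%g]mulg1 -(mulVg x); apply: (Hd); last exact: Hd.
    move=> _; have -> : (b^-1 * c = (b^-1 * (c * a^-1 * g)) * (a^-1 * g)^-1)%g.
      by rewrite !gnorm.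
    rewrite -[X in H i (X * _)%g]invgK; apply: (Hd); exact: Hv.
  exists j, (a * c^-1 * b)%g; split => //.
    by rewrite mem_cat; apply/orP; right; apply/allpairsP; exists (a, b).
  by have -> : ((a * c^-1 * b)^-1 * g = b^-1 * (c * a^-1 * g))%g by rewrite !gnorm.
exists i; rewrite inE eqxx; split => //; exists A => g.
apply: contrapT => ng; apply: all_c; exists g => a aA Ha; apply: ng.
by exists a.
Qed.

Definition centralizer_mod N x : set G := [set g | N (x^-1 * (g * x * g^-1))%g].

Lemma centralizer_mod_div N x g h : normal_subgroup N ->
  centralizer_mod N x g -> centralizer_mod N x h ->
  centralizer_mod N x (g^-1 * h)%g.
Proof.
rewrite /centralizer_mod /= => nN Ng Nh.
by have := nsubM nN (nsubJV g nN (nsubV nN Ng)) (nsubJV g nN Nh); rewrite !gnorm.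
Qed.

Lemma fc_mod_index N x (B : seq G) : normal_subgroup N ->
  (forall g, exists2 b, b \in B & centralizer_mod N x (b^-1 * g)%g) ->
  fc_mod N x.
Proof.
move=> nN cov.
have /choice[b bP] : forall g, exists b,
    b \in B /\ centralizer_mod N x (b^-1 * g)%g.
  by move=> g; have [b] := cov g; exists b.
exists ('I_(size B).+1), (fun g => inord (index (b g) B)) => s t.
have [sB sC] := bP s; have [tB tC] := bP t.
move=> /(congr1 val); rewrite /= !inordK ?ltnS ?index_size// => e.
have bst : b s = b t.
  by rewrite -(nth_index 1%g sB) e nth_index.
rewrite bst in sC; have := centralizer_mod_div nN sC tC.
rewrite /centralizer_mod /= => /(nsubJ s nN).
by rewrite !gnorm.
Qed.

(** If every [g] failed, each would lie in some [s N], inside a coset of the centraliser of [a]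
    modulo [N], or would conjugate some [x] outside [N] to some [y] modulo [N], and so lie in a
    coset of the centraliser of [x]. By Neumann's lemma one of these centralisers has finite index,
    against [fc_closed]. *)
Lemma switching N (a : G) (S : seq G) :
    normal_subgroup N -> fc_closed N -> ~ N a ->
  exists g, (forall x y, x \in S -> y \in S ->
      N (y^-1 * (g * x * g^-1))%g -> N x) /\
    (forall s, s \in S -> ~ N (s^-1 * g)%g).
Proof.
move=> nN cN Na; apply: contrapT => bad.
(* Elements of [N] are replaced by [a], so that the covering involves only centralisers of elements
   outside [N]. *)
pose good x := if pselect (N x) then a else x.
have goodN x : ~ N (good x) by rewrite /good; case: pselect.
pose w x y := xget 1%g [set g | N (y^-1 * (g * x * g^-1))%g].
have [| |x [xS [B covB]]] := @neumann G (fun x => centralizer_mod N x)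
  (a :: [seq good x | x <- S]) (S ++ [seq w x y | x <- S, y <- S]).
- by move=> x g h; exact: centralizer_mod_div.
- move=> g; apply: contrapT => ng; apply: bad; exists g; split; last first.
    move=> s sS Nsg; apply: ng; exists a, s; split; rewrite ?inE ?eqxx//.
      by rewrite mem_cat sS.
    rewrite /centralizer_mod /=.
    have := nsubM nN (nsubJ (a^-1)%g nN Nsg) (nsubV nN Nsg).
    by rewrite !gnorm.
  move=> x y xS yS Nxy; apply: contrapT => Nx; apply: ng.
  exists (good x), (w x y); split.
  - by rewrite inE map_f ?orbT.
  - by rewrite mem_cat; apply/orP; right; apply/allpairsP; exists (x, y).
  have -> : good x = x by rewrite /good; case: pselect.
  have : N (y^-1 * (w x y * x * (w x y)^-1))%g.
    exact: (@xgetPex _ 1%g [set g | N (y^-1 * (g * x * g^-1))%g] (ex_intro _ g Nxy)).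
  rewrite /centralizer_mod /=; move: (w x y) => v Nv.
  have := nsubM nN (nsubV nN Nv) Nxy => /(nsubJV v nN).
  by rewrite !gnorm.
have := cN _ (fc_mod_index nN covB).
by move: xS; rewrite inE => /orP[/eqP ->//|/mapP[y _ ->]]; exact: goodN.
Qed.

(* The hypothesis on [G] says that its upper FC-series is exhaustive.  The
   centraliser of [H0] modulo [K] is FC-closed, hence everything. *)
Lemma fc_closed_finite_index (H0 K : set G) (T : finType) (D : G -> T) :
    (forall N, normal_subgroup N -> fc_closed N -> N = setT) ->
    normal_subgroup H0 -> normal_subgroup K -> K `<=` H0 ->
    (forall s t, D s = D t -> H0 (s^-1 * t)%g) ->
    (forall k, H0 k -> fc_mod K k -> K k) ->
  H0 `<=` K.
Proof.
move=> hG nH nK KH DH Kfc.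
pose L := [set g | forall h, H0 h -> K (h^-1 * (g * h * g^-1))%g].
have LK g : L g -> H0 g -> K g.
  move=> Lg Hg; apply: Kfc => //; exists T, D => s t /DH Hst.
  have := Lg _ (nsubV nH Hst).
  by move=> /(nsubJV g nK) /(nsubJ s nK); rewrite !gnorm.
have nL : normal_subgroup L.
  split.
  - by move=> h _; rewrite !gnorm; exact: nsub1.
  - move=> g g' Lg Lg' h Hh.
    have /(nsubV nK) k1 := Lg _ (nsubJV g nH Hh).
    have /(nsubJV g nK) k2 := Lg' _ Hh.
    by have := nsubM nK k1 k2; rewrite !gnorm.
  - move=> t g Lg h Hh.
    by have /(nsubJ t nK) := Lg _ (nsubJV t nH Hh); rewrite !gnorm.
have cL : fc_closed L.
  move=> g [T' [D' DP]] h Hh.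
  have Hgh : H0 (h^-1 * (g * h * g^-1))%g.
    by apply: nsubM => //; [exact: nsubV|exact: nsubJ].
  (* A conjugate of the commutator by [t] is the product of the conjugates of [g] by [t h^-1] and of
     [g^-1] by [t]. The last two colours fix these modulo [L]; the first puts the discrepancies into
     [H0], where [L] is contained in [K]. *)
  apply: Kfc => //; exists (T * T' * T')%type.
  exists (fun t => (D t, D' t, D' (t * h^-1)%g)) => s t [/DH Hst e1 e2].
  have LHK u v : D' (s * u)%g = D' (t * u)%g -> v = (u^-1 * (s^-1 * t) * u)%g ->
      H0 v /\ K (g^-1 * (v * g * v^-1))%g.
    move=> /DP Luv ve; have Hv : H0 v by rewrite ve; exact: nsubJV.
    split => //; apply: LK.
      by have := nsubJV (s * u)%g nL Luv; rewrite ve !gnorm.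
    have := nsubM nH (nsubJV g nH Hv) (nsubV nH Hv).
    by rewrite !gnorm.
  have [_ K1] := LHK 1%g _ (ltac:(by rewrite !mulg1)) (erefl _).
  have [_ K2] := LHK (h^-1)%g _ e2 (erefl _).
  move: K1 K2; set u := (s^-1 * t)%g; rewrite !gnorm => K1 K2.
  have -> : t = (s * u)%g by rewrite /u !gnorm.
  have := nsubM nK (nsubJ g nK (nsubJV h nK K2)) (nsubJ g nK (nsubV nK K1)).
  by move=> /(nsubJ s nK); rewrite !gnorm.
by move=> g Hg; apply: LK => //; rewrite (hG L nL cL).
Qed.

End fc_classes.

Local Open Scope ring_scope.

(** * Averages of bounded functions *)

Lemma esumZl (R : realType) (T : choiceType) (A : set T) (r : R) (a : T -> R) :
  0 <= r -> (forall t, 0 <= a t) ->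
  (\esum_(t in A) (r * a t)%:E = r%:E * \esum_(t in A) (a t)%:E)%E.
Proof.
move=> r0 a0; rewrite /esum -ereal_supZl//; last first.
  by apply/set0P; exists 0%E; exists set0; [exact: fsets_set0|rewrite fsbig_set0].
congr ereal_sup; apply/seteqP; split=> [_ [F FA <-]|_ [_ [F FA <-] <-]].
- exists (\sum_(x \in F) (a x)%:E)%E; first by exists F.
  rewrite ge0_mule_fsumr; first by under [RHS]eq_fsbigr do rewrite EFinM.
  by move=> t; rewrite lee_fin.
- exists F => //; rewrite ge0_mule_fsumr; first by under eq_fsbigr do rewrite EFinM.
  by move=> t; rewrite lee_fin.
Qed.

Section averages.
Context {R : realType} {T : choiceType}.
Implicit Types (A : set T) (p a b c f g : T -> R).

Definition bnd f : Prop := exists B : R, forall t, `|f t| <= B.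

Lemma bndB f g : bnd f -> bnd g -> bnd (fun t => f t - g t).
Proof.
move=> [B fB] [C gC]; exists (B + C) => t.
by rewrite (le_trans (ler_normB _ _))// lerD.
Qed.

Lemma bnd_cst (r : R) : bnd (fun=> r).
Proof. by exists `|r|. Qed.

Lemma bnd01 f : (forall t, 0 <= f t <= 1) -> bnd f.
Proof. by move=> f01; exists 1 => t; have /andP[f0 f1] := f01 t; rewrite ger0_norm. Qed.

(** Positive part plus [c] equals negative part plus [b] pointwise, and all four sums are finite.
    Choosing [b] and [c] freely is what makes averages additive. *)
Lemma rsum_split A a b c :
  (forall t, 0 <= b t) -> (forall t, 0 <= c t) -> (forall t, a t = b t - c t) ->
  (\esum_(t in A) (b t)%:E < +oo)%E -> (\esum_(t in A) (c t)%:E < +oo)%E ->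
  rsum A a = fine (\esum_(t in A) (b t)%:E) - fine (\esum_(t in A) (c t)%:E).
Proof.
move=> b0 c0 aE bfin cfin; rewrite /rsum.
set p := (fun t => (a t)%:E)^\+%E; set n := (fun t => (a t)%:E)^\-%E.
have p0 t : (0 <= p t)%E by exact: funepos_ge0.
have n0 t : (0 <= n t)%E by exact: funeneg_ge0.
have pb t : (p t <= (b t)%:E)%E.
  by rewrite /p funeposE ge_max lee_fin aE gerBl ?c0// lee_fin b0.
have nc t : (n t <= (c t)%:E)%E.
  by rewrite /n funenegE ge_max -EFinN lee_fin aE opprB gerBl ?b0// lee_fin c0.
have fin (e : T -> \bar R) : (forall t, 0 <= e t)%E ->
    (\esum_(t in A) e t < +oo)%E -> (\esum_(t in A) e t)%E \is a fin_num.
  by move=> e0 efin; rewrite ge0_fin_numE// esum_ge0.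
have bfn : (\esum_(t in A) (b t)%:E)%E \is a fin_num by apply: fin => // t; rewrite lee_fin.
have cfn : (\esum_(t in A) (c t)%:E)%E \is a fin_num by apply: fin => // t; rewrite lee_fin.
have pfn : (\esum_(t in A) p t)%E \is a fin_num.
  by apply: fin => //; apply: le_lt_trans bfin; apply: le_esum.
have nfn : (\esum_(t in A) n t)%E \is a fin_num.
  by apply: fin => //; apply: le_lt_trans cfin; apply: le_esum.
have : (\esum_(t in A) p t + \esum_(t in A) (c t)%:E =
        \esum_(t in A) n t + \esum_(t in A) (b t)%:E)%E.
  rewrite -!esumD//; last 2 first.
  - by move=> t _; rewrite lee_fin.
  - by move=> t _; rewrite lee_fin.
  apply: eq_esum => t _; rewrite /p /n funeposE funenegE -EFinN.
  rewrite -!EFin_max -!EFinD aE; congr (_%:E).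
  by case: (leP (b t - c t) 0) => h; case: (leP (- (b t - c t)) 0) => h'; lra.
move=> /(congr1 fine); rewrite !fineD//; lra.
Qed.

Variable p : T -> R.
Hypothesis pP : prob_mass [set: T] p.

Definition avg f : R := rsum [set: T] (fun t => p t * f t).

Let p0 t : 0 <= p t. Proof. by case: pP => p0 _; exact: p0. Qed.

Let esum_fin f B : (forall t, 0 <= f t <= B) ->
  (\esum_(t in [set: T]) (p t * f t)%:E < +oo)%E.
Proof.
move=> fB.
have [[t0]|no] := pselect (exists t : T, True); last first.
  rewrite esum1 ?ltry// => t; exfalso; apply: no; by exists t.
move=> _; have B0 : 0 <= B by have /andP[] := fB t0; exact: le_trans.
apply: (@le_lt_trans _ _ (\esum_(t in [set: T]) (\sum_(i < (Num.trunc B).+1) (p t)%:E))%E).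
  apply: le_esum => t _; rewrite sumEFin lee_fin sumr_const card_ord.
  rewrite -mulr_natr ler_wpM2l//; have /andP[_ /le_trans->//] := fB t.
  by rewrite ltW// truncnS_gt.
rewrite esum_sum; last by move=> *; rewrite lee_fin.
by case: pP => _ ->; rewrite sumEFin ltry.
Qed.

Lemma avg_split f b c B : (forall t, 0 <= b t <= B) -> (forall t, 0 <= c t <= B) ->
  (forall t, f t = b t - c t) ->
  avg f = fine (\esum_(t in [set: T]) (p t * b t)%:E) -
          fine (\esum_(t in [set: T]) (p t * c t)%:E).
Proof.
move=> bB cB fE; apply: rsum_split.
- by move=> t; rewrite mulr_ge0//; case/andP: (bB t).
- by move=> t; rewrite mulr_ge0//; case/andP: (cB t).
- by move=> t; rewrite fE mulrBr.
- exact: (esum_fin bB).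
- exact: (esum_fin cB).
Qed.

Lemma avgE f : (forall t, 0 <= f t) -> bnd f ->
  (avg f)%:E = (\esum_(t in [set: T]) (p t * f t)%:E)%E.
Proof.
move=> f0 [B fB].
have fB' t : 0 <= f t <= B by rewrite f0/= (le_trans _ (fB t))// ler_norm.
have B0 (t : T) : 0 <= B by exact: le_trans (fB t).
rewrite (@avg_split f f (fun=> 0) B)//; last 2 first.
- by move=> t; rewrite lexx B0.
- by move=> t; rewrite subr0.
rewrite [X in _ - fine X]esum1 ?subr0 ?fineK//; last by move=> t _; rewrite mulr0.
rewrite ge0_fin_numE; first exact: esum_fin fB'.
by apply: esum_ge0 => t _; rewrite lee_fin mulr_ge0.
Qed.

Lemma avgB f g : bnd f -> bnd g -> avg (fun t => f t - g t) = avg f - avg g.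
Proof.
move=> [B fB] [C gC]; set D := Num.max B C.
have fD t : `|f t| <= D by rewrite (le_trans (fB t))// le_max lexx.
have gD t : `|g t| <= D by rewrite (le_trans (gC t))// le_max lexx orbT.
have shift (h : T -> R) : (forall t, `|h t| <= D) -> forall t, 0 <= h t + D <= 2 * D.
  by move=> hD t; have := hD t; rewrite ler_norml => /andP[? ?]; apply/andP; split; lra.
have DD (t : T) : 0 <= D <= 2 * D by have := le_trans (normr_ge0 _) (fD t) => ?; apply/andP; split; lra.
rewrite (@avg_split _ (fun t => f t + D) (fun t => g t + D) (2 * D)); first last.
- by move=> t; ring.
- exact: shift.
- exact: shift.
rewrite (@avg_split f (fun t => f t + D) (fun=> D) (2 * D)); first last.
- by move=> t; ring.
- exact: DD.
- exact: shift.
rewrite (@avg_split g (fun t => g t + D) (fun=> D) (2 * D)); first last.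
- by move=> t; ring.
- exact: DD.
- exact: shift.
ring.
Qed.

Lemma avg_ge0 f : (forall t, 0 <= f t) -> 0 <= avg f.
Proof.
move=> f0; rewrite /avg /rsum [X in _ - fine X]esum1 ?subr0.
  by rewrite fine_ge0// esum_ge0// => t _; exact: funepos_ge0.
by move=> t _; rewrite funenegE max_r// -EFinN lee_fin oppr_le0 mulr_ge0.
Qed.

Lemma avg_le f g : bnd f -> bnd g -> (forall t, f t <= g t) -> avg f <= avg g.
Proof.
move=> bf bg fg; rewrite -subr_ge0 -avgB//.
by apply: avg_ge0 => t; rewrite subr_ge0.
Qed.

Lemma avg0 : avg (fun=> 0) = 0.
Proof.
rewrite /avg (@rsum_split _ _ (fun=> 0) (fun=> 0))//; first lra.
- by move=> t; rewrite mulr0 subr0.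
- by rewrite esum1 ?ltry.
- by rewrite esum1 ?ltry.
Qed.

Lemma avg_cst r : avg (fun=> r) = r.
Proof.
have pos s : 0 <= s -> avg (fun=> s) = s.
  move=> s0; apply: EFin_inj; rewrite avgE//; last exact: bnd_cst.
  under eq_esum do rewrite mulrC.
  by rewrite esumZl//; case: pP => _ ->; rewrite mule1.
wlog r0 : r / 0 <= r.
  move=> H; have [/H//|/ltW r0] := leP 0 r.
  have := @avgB (fun=> 0) (fun=> - r) (bnd_cst _) (bnd_cst _).
  rewrite avg0 (H (- r)) ?oppr_ge0// sub0r opprK => e; rewrite -[RHS]e.
  by congr avg; apply/funext => t; ring.
exact: pos.
Qed.

Lemma avg_point f t : (forall t, 0 <= f t) -> bnd f -> p t * f t <= avg f.
Proof.
move=> f0 bf; rewrite -lee_fin avgE//; apply: esum_ge; exists [set t].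
  by split.
by rewrite fsbig_set1.
Qed.

Lemma eq_avg f g : f =1 g -> avg f = avg g.
Proof. by move=> /funext ->. Qed.

End averages.

(* Knaster--Tarski, as averaging preserves the interval from [u] to [1 - v]. *)
Lemma harmonic_between (R : realType) (T : choiceType) (Z : Type)
    (w : Z -> T -> R) (nx : Z -> T -> Z) (u v : Z -> R) :
    (forall z, prob_mass [set: T] (w z)) ->
    (forall z, 0 <= u z) -> (forall z, 0 <= v z) -> (forall z, u z + v z <= 1) ->
    (forall z, u z <= avg (w z) (u \o nx z)) ->
    (forall z, v z <= avg (w z) (v \o nx z)) ->
  exists F : Z -> R, [/\ forall z, 0 <= F z <= 1, forall z, u z <= F z,
    forall z, F z + v z <= 1 & forall z, F z = avg (w z) (F \o nx z)].
Proof.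
move=> wP u0 v0 uv su sv.
pose Q F z := avg (w z) (F \o nx z).
pose S := [set F : Z -> R | [/\ forall z, u z <= F z, forall z, F z + v z <= 1
  & forall z, F z <= Q F z]].
have u1 z : u z <= 1 by have := uv z; have := v0 z; lra.
have v1 z : v z <= 1 by have := uv z; have := u0 z; lra.
have S01 F : S F -> forall z, 0 <= F z <= 1.
  move=> [uF Fv _] z; have := uF z; have := Fv z; have := u0 z; have := v0 z.
  by move=> *; apply/andP; split; lra.
pose F z := sup [set G z | G in S].
have Su : S u by [].
have Fub G : S G -> forall z, G z <= F z.
  move=> SG z; apply: ub_le_sup; last by exists G.
  by exists 1 => _ [H /S01/(_ z)/andP[_ ?] <-].
have Flub z r : (forall G, S G -> G z <= r) -> F z <= r.
  move=> Gr; apply: ge_sup; first by exists (u z), u.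
  by move=> _ [G SG <-]; exact: Gr.
have F01 z : 0 <= F z <= 1.
  rewrite (le_trans (u0 z) (Fub _ Su z))/= Flub// => G /S01/(_ z)/andP[]//.
have Fv z : F z + v z <= 1.
  by rewrite -lerBrDr Flub// => G [_ /(_ z)]; rewrite lerBrDr.
have b01 (G : Z -> R) z : (forall z, 0 <= G z <= 1) -> bnd (G \o nx z).
  by move=> G01; apply: bnd01 => t /=; exact: G01.
have FQ z : F z <= Q F z.
  apply: Flub => G SG; case: (SG) => _ _ /(_ z)/le_trans; apply.
  apply: avg_le => //; [exact/b01/S01|exact/b01|by move=> t; exact: Fub].
have v01 z : 0 <= v z <= 1 by rewrite v0 v1.
have Q01 z : 0 <= Q F z <= 1.
  rewrite avg_ge0//=; last by move=> t; case/andP: (F01 (nx z t)).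
  rewrite -(avg_cst (wP z) 1); apply: avg_le => //; first exact: b01.
    exact: bnd_cst.
  by move=> t; case/andP: (F01 (nx z t)).
have SQ : S (Q F).
  split=> z.
  - exact: le_trans (Fub _ Su z) (FQ z).
  - rewrite -lerBrDr.
    suff : Q F z <= 1 - avg (w z) (v \o nx z) by have := sv z; lra.
    rewrite -(avg_cst (wP z) 1) -avgB//; [|exact: bnd_cst|exact: b01].
    apply: avg_le => //; [exact: b01|apply: bndB; [exact: bnd_cst|exact: b01]|].
    by move=> t /=; rewrite lerBrDr.
  - by apply: avg_le => //; [exact: b01|exact: b01|move=> t; exact: FQ].
exists F; split => // [z|z]; first exact: Fub.
by apply/eqP; rewrite eq_le FQ/=; exact: (Fub _ SQ).
Qed.

Section push_forward.
Context {R : realType} {I T : choiceType}.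
Variables (w : I -> R) (l : I -> T).
Hypothesis wP : prob_mass [set: I] w.

Definition push_mass (t : T) : R := fine (\esum_(i in [set i | l i = t]) (w i)%:E).

Let w0 i : 0 <= w i. Proof. by case: wP => w0 _; exact: w0. Qed.

Let push_massE t :
  (push_mass t)%:E = (\esum_(i in [set i | l i = t]) (w i)%:E)%E.
Proof.
rewrite fineK// ge0_fin_numE; last by apply: esum_ge0 => i _; rewrite lee_fin.
apply: le_lt_trans (ltry 1); case: wP => _ <-.
rewrite esum_mkcond; apply: le_esum => i _.
by case: ifP => // _; rewrite lee_fin.
Qed.

Lemma esum_push_mass F : (forall t, 0 <= F t) ->
  (\esum_(t in [set: T]) (push_mass t * F t)%:E =
   \esum_(i in [set: I]) (w i * F (l i))%:E)%E.
Proof.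
move=> F0.
transitivity (\esum_(t in [set: T])
    \esum_(i in [set i | l i = t]) (w i * F (l i))%:E)%E.
  apply: eq_esum => t _; rewrite mulrC EFinM push_massE -esumZl//.
  by apply: eq_esum => i /= ->; rewrite mulrC.
rewrite esum_esum; last by move=> *; rewrite lee_fin mulr_ge0.
rewrite (@reindex_esum _ _ _ [set: I] _ (fun i => (l i, i)))//.
split=> [i _|i j _ _ [_ ->]|[t i] [_ /= <-]] //=; by exists i.
Qed.

Lemma prob_mass_push_mass : prob_mass [set: T] push_mass.
Proof.
split=> [t _|]; first by rewrite fine_ge0// esum_ge0// => i _; rewrite lee_fin.
have := @esum_push_mass (fun=> 1) (fun=> ler01).
by under eq_esum do rewrite mulr1; move=> ->; under eq_esum do rewrite mulr1; case: wP.
Qed.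

Lemma push_mass_ge i : w i <= push_mass (l i).
Proof.
rewrite -lee_fin push_massE; apply: esum_ge; exists [set i]; last by rewrite fsbig_set1.
by split => // _ ->.
Qed.

End push_forward.

Section complex_averages.
Local Open Scope complex_scope.
Context {R : realType} {T : choiceType}.
Implicit Types (A : set T) (p : T -> R) (f : T -> R[i]).

Lemma csum_avg p f : csum [set: T] (fun t => (p t)%:C * f t) =
  avg p (fun t => complex.Re (f t)) +i* avg p (fun t => complex.Im (f t)).
Proof.
rewrite /csum; congr (_ +i* _); congr rsum; apply/funext => t.
  by case: (f t) => a b /=; rewrite mul0r subr0.
by case: (f t) => a b /=; rewrite mul0r addr0.
Qed.

Lemma csum_avg_real p (F : T -> R) :
  csum [set: T] (fun t => (p t)%:C * (F t)%:C) = (avg p F)%:C.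
Proof.
rewrite csum_avg /=; congr (_ +i* _); rewrite /avg.
have -> : (fun t => p t * 0) = (fun=> 0) :> (T -> R).
  by apply/funext => t; rewrite mulr0.
by rewrite /rsum !esum1 ?subrr// => t _; rewrite (funeposE, funenegE) ?oppr0 max_r// lee_fin oppr0.
Qed.

Lemma reindex_csum (T' : choiceType) A (B : set T') (e : T' -> T) (a : T -> R[i]) :
  set_bij B A e -> csum A a = csum B (a \o e).
Proof.
move=> eb; rewrite /csum /rsum !(reindex_esum _ _ _ _ eb).
congr (_ +i* _); congr (fine _ - fine _); apply: eq_esum => t _ //=;
  by rewrite (funeposE, funenegE) /= (funeposE, funenegE).
Qed.

Lemma norm_Re_le (z : R[i]) (M : R) : `|z| <= M%:C -> `|complex.Re z| <= M.
Proof.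
rewrite normc_def lecR; apply: le_trans.
by rewrite -sqrtr_sqr ler_wsqrtr// lerDl sqr_ge0.
Qed.

Lemma norm_Im_le (z : R[i]) (M : R) : `|z| <= M%:C -> `|complex.Im z| <= M.
Proof.
rewrite normc_def lecR; apply: le_trans.
by rewrite -sqrtr_sqr ler_wsqrtr// lerDr sqr_ge0.
Qed.

Lemma norm_real_complex (r : R) : `|r%:C| = `|r|%:C :> R[i].
Proof. by rewrite normc_def /= expr0n addr0 sqrtr_sqr. Qed.

End complex_averages.

(** * Markov operators on transformation groupoids *)

Lemma countable_enum (T : choiceType) (t0 : T) : countable [set: T] ->
  exists e : nat -> T, forall t, exists n, e n = t.
Proof.
move=> cT; have [i inj] := countable_injP _ cT; exists (fun n => xget t0 [set t | i t = n]) => t.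
exists (i t); case: xgetP => [s _ /= /inj->//|/(_ t)/(_ erefl)//]; rewrite ?inE//.
Qed.

Lemma measurable_esum (R : realType) (T : choiceType) (d : measure_display)
    (Y : measurableType d) (F : T -> Y -> \bar R) : countable [set: T] ->
  (forall t y, 0 <= F t y)%E -> (forall t, measurable_fun [set: Y] (F t)) ->
  measurable_fun [set: Y] (fun y => \esum_(t in [set: T]) F t y)%E.
Proof.
move=> cT F0 mF.
have [[t0 _]|no] := pselect (exists t : T, True); last first.
  rewrite (_ : (fun y => _) = cst 0%E); first exact: measurable_cst.
  by apply/funext => y; apply: esum1 => t _; exfalso; apply: no; exists t.
have [i inj] := countable_injP _ cT.
pose e n := xget t0 [set t | i t = n].
have ei t : e (i t) = t.
  rewrite /e; case: xgetP => [s _ /= /inj->//|/(_ t)/(_ erefl)//]; rewrite ?inE//.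
rewrite (_ : (fun y => _) = fun y => (\sum_(n <oo | n \in range i) F (e n) y)%E).
  apply: ge0_emeasurable_sum => // n y _ _; exact: F0.
apply/funext => y; rewrite nneseries_esum; last by move=> n _; exact: F0.
transitivity (\esum_(t in e @` [set n | n \in range i]) F t y)%E; last first.
  rewrite esum_image// => m n /set_mem/set_mem[s _ <-] /set_mem/set_mem[t _ <-].
  by rewrite !ei => ->.
congr esum; apply/seteqP; split => // t _; exists (i t) => //=.
by rewrite inE; exists t.
Qed.

Lemma measurable_sections (G : groupType) (d d' : measure_display)
    (X : measurableType d) (Y : measurableType d') (f : discrete G * X -> Y) :
  countable [set: G] -> (forall g, measurable_fun [set: X] (fun x => f (g, x))) ->
  measurable_fun [set: discrete G * X] f.
Proof.
move=> cG mf _ B mB; rewrite setTI.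
have [e eP] := countable_enum (1%g : G) cG.
rewrite (_ : f @^-1` B =
    \bigcup_n ([set (e n : discrete G)] `*` ((fun x => f (e n, x)) @^-1` B))).
  apply: bigcupT_measurable => n; apply: measurableX => //.
  by rewrite -[X in measurable X]setTI; exact: mf.
apply/seteqP; split=> [[g x] /= Bgx|[g x] [n _ [/= -> //]]].
by have [n en] := eP g; exists n => //; rewrite /= en.
Qed.

Lemma measurable_section (G : groupType) (d d' : measure_display)
    (X : measurableType d) (Y : measurableType d') (f : discrete G * X -> Y) g :
  measurable_fun [set: discrete G * X] f -> measurable_fun [set: X] (fun x => f (g, x)).
Proof.
move=> mf; apply: (measurableT_comp mf).
exact: measurable_fun_pair.
Qed.

Section transformation.
Variables (R : realType) (G : groupType) (d : measure_display).
Variables (X : measurableType d) (act : G -> X -> X).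
Hypotheses (cG : countable [set: G]) (actP : is_action act).
Local Notation groupoid := (discrete G * X)%type.

(** This coordinate turns every fibre into a copy of [G] and the product with [(g, y)] into left
    translation by [g]. The operator becomes a walk on [G] whose step law at [g] is the one over
    [act g^-1 x]. *)
Definition arrow (x : X) (h : G) : groupoid := (h, act h^-1%g x).

Lemma actK h : cancel (act h) (act h^-1%g).
Proof. by case: actP => a1 aM x; rewrite -aM mulVg a1. Qed.

Lemma actKV h : cancel (act h^-1%g) (act h).
Proof. by case: actP => a1 aM x; rewrite -aM mulgV a1. Qed.

Lemma arrow_fiber x h : fiber act x (arrow x h).
Proof. by rewrite /fiber /target /= actKV. Qed.

Lemma fiber_arrow x a : fiber act x a -> a = arrow x a.1.
Proof. by case: a => g y; rewrite /fiber /target /arrow /= => <-; rewrite actK. Qed.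

Lemma arrow_bij x : set_bij [set: G] (fiber act x) (arrow x).
Proof.
split; first by move=> h _; exact: arrow_fiber.
- by move=> g h _ _ [].
- by move=> a /fiber_arrow ->; exists a.1.
Qed.

Lemma prob_mass_fiber x (p : groupoid -> R) :
  prob_mass (fiber act x) p <-> prob_mass [set: G] (p \o arrow x).
Proof.
rewrite /prob_mass (reindex_esum _ _ _ _ (arrow_bij x)).
split=> -[p0 p1]; split => //.
  by move=> h _; apply: p0; exact: arrow_fiber.
by move=> a /fiber_arrow ->; exact: p0.
Qed.

Lemma markov_opE (P : X -> groupoid -> R) f g y :
  markov_op act P f (g, y) =
  csum [set: G] (fun h => (P y (arrow y h))%:C%C * f (arrow (act g y) (g * h)%g)).
Proof.
rewrite /markov_op (reindex_csum _ (arrow_bij y)).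
congr csum; apply/funext => h /=; congr (_ * f _).
rewrite /gpd_mul /arrow /=; congr (_, _).
by case: actP => _ aM; rewrite -aM invgM -mulgA mulVg mulg1.
Qed.

Hypothesis mact : borel_action act.

Lemma measurable_act g : measurable_fun [set: X] (act g).
Proof. exact: (measurable_section g mact). Qed.

Definition markov_of (p : X -> G -> R) : X -> groupoid -> R := fun x a => p x a.1.

Lemma invariant_markov_of (p : X -> G -> R) :
  (forall x, prob_mass [set: G] (p x)) ->
  (forall h, measurable_fun [set: X] (p^~ h)) ->
  invariant_markov act (markov_of p).
Proof.
move=> pP mp; split=> [x|f mf f0]; first by apply/prob_mass_fiber; exact: pP.
apply: measurable_sections => // g.
rewrite (_ : (fun x => _) = fun x => (\esum_(h in [set: G])
    (p x h * f ((g * h)%g, act h^-1%g x))%:E)%E).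
  apply: measurable_esum => // [h x|h].
    by rewrite lee_fin mulr_ge0//; case: (pP x) => p0 _; exact: p0.
  apply/measurable_EFinP; apply: measurable_funM; first exact: mp.
  apply: measurableT_comp mf _; apply: measurable_fun_pair => //.
  exact: measurable_act.
by apply/funext => x; rewrite (reindex_esum _ _ _ _ (arrow_bij x)).
Qed.

End transformation.

(** * Finite orbits *)

Lemma uniform_pos (R : realType) (I : eqType) (s : seq I) (Q : I -> R -> Prop) :
  (forall i, exists2 w, 0 < w & Q i w) ->
  (forall i w w', Q i w -> w' <= w -> Q i w') ->
  exists2 w, 0 < w & forall i, i \in s -> Q i w.
Proof.
move=> Qpos Qle; elim: s => [|i s [w w0 IH]]; first by exists 1.
have [v v0 Qv] := Qpos i; exists (Num.min v w); first by rewrite lt_min v0.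
move=> j; rewrite inE => /orP[/eqP ->|/IH Qj].
  by apply: Qle Qv _; rewrite ge_min lexx.
by apply: Qle Qj _; rewrite ge_min lexx orbT.
Qed.

Section finite_orbits.
Variables (R : realType) (G : groupType) (d : measure_display).
Variables (X : measurableType d) (act : G -> X -> X).
Hypothesis actP : is_action act.
Local Notation groupoid := (discrete G * X)%type.
Variable P : X -> groupoid -> R.
Hypothesis Pmass : forall x, prob_mass (fiber act x) (P x).
Hypothesis Pnd : Defs.nondegenerate act P.

Let act1 x : act 1%g x = x. Proof. by case: actP. Qed.
Let actM g h x : act (g * h)%g x = act g (act h x). Proof. by case: actP. Qed.

Let p x h := P x (arrow act x h).
Let pP x : prob_mass [set: G] (p x). Proof. exact/prob_mass_fiber. Qed.

Definition har x (f : G -> R) : Prop :=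
  bnd f /\ forall g, f g = avg (p (act g^-1%g x)) (fun h => f (g * h)%g).

Lemma bnd_shift (f : G -> R) g : bnd f -> bnd (fun h => f (g * h)%g).
Proof. by move=> [B fB]; exists B. Qed.

Lemma har_shift x f k : har x f -> har (act k^-1%g x) (fun g => f (k * g)%g).
Proof.
move=> [bf hf]; split=> [|g]; first exact: bnd_shift.
rewrite hf invgM actM; apply: eq_avg => h; by rewrite mulgA.
Qed.

Lemma harB x f f' : har x f -> har x f' -> har x (fun g => f g - f' g).
Proof.
move=> [bf hf] [bf' hf']; split=> [|g]; first exact: bndB.
by rewrite {1}hf {1}hf' -avgB//; exact: bnd_shift.
Qed.

Lemma har_cst x r : har x (fun=> r).
Proof. by split=> [|g]; [exact: bnd_cst|rewrite avg_cst]. Qed.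

Definition harnack x g w : Prop :=
  forall f, har x f -> (forall g, 0 <= f g) -> w * f g <= f 1%g.

(** Positive mass of a power provides a path of arrows of positive mass from the identity to [g].
    Each step bounds an average below by one of its terms, so [w] is the product of the masses along
    the path. *)
Lemma harnack_markov_pow n x g : (0 < markov_pow act P n x (arrow act x g))%E ->
  exists2 w, 0 < w & harnack x g w.
Proof.
elim: n x g => [x g|n IH x g] /=.
  rewrite lte_fin => Pg; exists (P x (arrow act x g)) => // f [bf hf] f0.
  rewrite [leRHS]hf invg1 act1.
  under eq_avg do rewrite mul1g.
  exact: avg_point.
move=> pos; have [k kpos] : exists k, (0 < (p x k)%:E *
    markov_pow act P n (act k^-1%g x) (arrow act (act k^-1%g x) (k^-1 * g)%g))%E.
  apply: contrapT => nk; move: pos; apply/negP; rewrite -leNgt.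
  rewrite (reindex_esum _ _ _ _ (arrow_bij actP x)).
  rewrite -[leRHS](@esum1 R G [set: G] (fun=> 0%E))//.
  apply: le_esum => k _; rewrite leNgt; apply/negP => kpos; apply: nk; exists k.
  rewrite /p; move: kpos; rewrite /gpd_mul /gpd_inv /arrow /source /=.
  by rewrite invgM invgK -actM !gnorm.
have p0 : 0 <= p x k by case: (pP x) => p0 _; exact: p0.
have {}p0 : 0 < p x k.
  by rewrite lt_neqAle p0 andbT; apply/eqP => e; move: kpos; rewrite -e mul0e ltxx.
move: kpos; rewrite pmule_rgt0 ?lte_fin// => /IH[w w0 wP].
exists (p x k * w) => [|f hf f0]; first exact: mulr_gt0.
have := wP _ (har_shift k hf) (fun g => f0 _).
rewrite mulg1 !gnorm => wk; rewrite -mulrA (le_trans (ler_wpM2l (ltW p0) wk))//.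
case: hf => bf hf; rewrite [leRHS]hf invg1 act1.
under eq_avg do rewrite mul1g.
exact: avg_point.
Qed.

Lemma harnack_all x g : exists2 w, 0 < w & harnack x g w.
Proof.
have : fiber act x (arrow act x g) by exact: arrow_fiber.
by rewrite -Pnd => -[n _ [_]]; exact: harnack_markov_pow.
Qed.

Variable x0 : X.
Hypothesis fin : finite_set (orbit_of act x0).
Local Notation Y := (orbit_of act x0).

Let Yact g y : Y y -> Y (act g y).
Proof. by move=> [h _ <-]; exists (g * h)%g; rewrite ?actM. Qed.

Definition orbit_kernel : set G := [set k | forall y, Y y -> act k y = y].

Lemma orbit_kernel_normal : normal_subgroup orbit_kernel.
Proof.
split.
- by move=> y _.
- by move=> g h Hg Hh y Yy; rewrite actM Hh// -{1}(Hg y Yy) actK.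
- by move=> g k Hk y Yy; rewrite !actM Hk ?actKV//; exact: Yact.
Qed.

Lemma orbit_kernel_index : exists (T : finType) (D : G -> T),
  forall s t, D s = D t -> orbit_kernel (s^-1 * t)%g.
Proof.
have /finite_seqP[ys ysP] := fin.
have Yin y : Y y -> y \in ys by rewrite ysP.
exists {ffun 'I_(size ys) -> 'I_(size ys).+1}.
exists (fun t => [ffun i : 'I_(size ys) => inord (index (act t (nth x0 ys i)) ys)]).
move=> s t /ffunP e y Yy.
have iy : (index y ys < size ys)%N by rewrite index_mem Yin.
have := congr1 val (e (Ordinal iy)).
rewrite !ffunE /= !inordK ?ltnS ?index_size// nth_index ?Yin// => {}e.
rewrite actM -[act t y](nth_index x0 (Yin _ (Yact t Yy))) -e nth_index ?actK//.
exact/Yin/Yact.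
Qed.

(** All points of the orbit are involved because translation by [a] moves the base point from [y] to
    [act a^-1 y]; this is what makes the kernel normal. *)
Definition har_kernel : set G := [set k | orbit_kernel k /\
  forall y f, Y y -> har y f -> forall g, f (k * g)%g = f g].

Lemma har_kernel_normal : normal_subgroup har_kernel.
Proof.
have nH := orbit_kernel_normal; split.
- by split; [exact: (nsub1 nH)|move=> *; rewrite mul1g].
- move=> k l [Hk fk] [Hl fl]; split; first by case: nH => _ + _; apply.
  move=> y f Yy hf g.
  by rewrite -(fk y f Yy hf (k^-1 * l * g)%g) -(fl y f Yy hf g) !gnorm.
- move=> a k [Hk fk]; split; first exact: (nsubJ a nH).
  move=> y f Yy hf g.
  have := fk _ _ (Yact a^-1%g Yy) (har_shift a hf) (a^-1 * g)%g.
  by rewrite !gnorm.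
Qed.

(* If the supremum of the increments were attained by [f] at the identity, all
   increments of [f] along the powers of a conjugate of [k] would equal it and
   [f] would be unbounded; Harnack's inequality makes this quantitative, uniformly
   over the finitely many conjugates. *)
Lemma har_kernel_fc_sup k M : orbit_kernel k -> fc_mod har_kernel k ->
  forall y f t, Y y -> har y f -> (forall g, `|f g| <= M) ->
    f (t * k * t^-1)%g <= f 1%g.
Proof.
move=> Hk [T [D DP]].
(* Since [y], [f] and [t] all vary, [S] is stable under translation: the increment of [f] at any [g]
   is again a member. *)
pose S := [set r : R | exists y f t, [/\ Y y, har y f, (forall g, `|f g| <= M)
  & r = f (t * k * t^-1)%g - f 1%g]].
suff sup0 : sup S <= 0.
  move=> y f t Yy hf fM; rewrite -subr_le0; apply: le_trans sup0.
  apply: ub_le_sup; last by exists y, f, t.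
  exists (M + M) => _ [y' [f' [t' [_ _ f'M ->]]]].
  by rewrite (le_trans (ler_norm _))// (le_trans (ler_normB _ _))// lerD.
have ubS : has_ubound S.
  exists (M + M) => _ [y' [f' [t' [_ _ f'M ->]]]].
  by rewrite (le_trans (ler_norm _))// (le_trans (ler_normB _ _))// lerD.
have [[r0 Sr0]|noS] := pselect (S !=set0); last first.
  by rewrite sup_out// => -[].
rewrite leNgt; apply/negP => s0; set s := sup S in s0.
(* Climbing [n] steps of height [s / 2] exceeds the oscillation [2 * M]. *)
have [n nM] : exists n : nat, 2 * M < n%:R * (s / 2).
  exists (Num.trunc (2 * M / (s / 2))).+1.
  by rewrite -ltr_pdivrMr ?divr_gt0// truncnS_gt.
have /finite_seqP[ys ysP] := fin.
pose rep c := xget 1%g [set t | D t = c].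
pose kc c := (rep c * k * (rep c)^-1)%g.
(* One Harnack constant serves all points of the orbit and all powers below [n] of the finitely many
   conjugates; it is fixed before the nearly extremal [f] is chosen. *)
have [w w0 wP] := @uniform_pos R (X * G)%type
  [seq (y, g) | y <- ys, g <- [seq (kc c ^+ i)%g | c <- enum T, i <- iota 0 n]]
  (fun a w => harnack a.1 a.2 w) (fun a => harnack_all a.1 a.2)
  (fun a w w' hw ww' f hf f0 => le_trans (ler_wpM2r (f0 a.2) ww') (hw f hf f0)).
have [_ [y [f [t [Yy hf fM ->]]]]] : exists2 r, S r & s - w * (s / 2) < r.
  apply: sup_adherent; first by rewrite mulr_gt0 ?divr_gt0.
  by split => //; exists r0.
move=> near_sup.
have nK := har_kernel_normal.
have Hkc c : orbit_kernel (kc c) by exact: (nsubJ (rep c) orbit_kernel_normal).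
have kcE g : f (kc (D t) * g)%g = f (t * k * t^-1 * g)%g.
  have e : D t = D (rep (D t)).
    by rewrite /rep; case: xgetP => [u _ ->//|/(_ t)/(_ erefl)].
  have [_ /(_ y f Yy hf (kc (D t) * g)%g)] :=
    nsubJ (kc (D t)) nK (nsubV nK (DP _ _ e)).
  by rewrite /kc !gnorm => ->.
pose u g := f (kc (D t) * g)%g - f g.
have us g : u g <= s.
  apply: ub_le_sup => //.
  exists (act g^-1%g y), (fun h => f (g * h)%g), (g^-1 * t)%g; split => //.
  - exact: Yact.
  - exact: har_shift.
  - by rewrite /u kcE !gnorm.
have hu : har y (fun g => s - u g).
  apply: harB; first exact: har_cst.
  apply: harB => //.
  (* The conjugate fixes [y], so translating by it does not move the base point. *)
  rewrite -{1}(nsubV orbit_kernel_normal (Hkc (D t)) y Yy).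
  exact: har_shift.
(* A deficit [s - u] above [s / 2] at this power would, by Harnack, exceed [w * (s / 2)] at the
   identity, against the choice of [f]. *)
have u_large i : (i < n)%N -> s / 2 <= u (kc (D t) ^+ i)%g.
  move=> i_n; rewrite leNgt; apply/negP => us2.
  have /wP/(_ _ hu) : (y, (kc (D t) ^+ i)%g) \in
      [seq (y, g) | y <- ys, g <- [seq (kc c ^+ i)%g | c <- enum T, i <- iota 0 n]].
    apply/allpairsP; exists (y, (kc (D t) ^+ i)%g); split => //=.
      by move: Yy; rewrite ysP.
    by apply/allpairsP; exists (D t, i); rewrite mem_enum mem_iota.
  have /[swap]/[apply] : forall g, 0 <= s - u g by move=> g; rewrite subr_ge0.
  have u1 : u 1%g = f (t * k * t^-1)%g - f 1%g by rewrite /u kcE mulg1.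
  rewrite /= u1 => wle.
  have : w * (s / 2) < w * (s - u (kc (D t) ^+ i)%g) by rewrite ltr_pM2l//; lra.
  by move: wle near_sup; rewrite -/s; lra.
have climb i : (i <= n)%N -> i%:R * (s / 2) <= f (kc (D t) ^+ i)%g - f 1%g.
  elim: i => [_|i IH i_n]; first by rewrite mul0r expg0 subrr.
  have := u_large i i_n; have := IH (ltnW i_n).
  by rewrite /u -expgS -[i.+1]addn1 natrD mulrDl mul1r addn1; lra.
have := climb n (leqnn n); have := fM (kc (D t) ^+ n)%g; have := fM 1%g.
rewrite !ler_norml => /andP[? ?] /andP[? ?]; lra.
Qed.

(** The bound at the identity, applied to the translate of [f] by [g] and the conjugate of [k] by
    [g^-1], reads [f (k * g) <= f g]; the same for [0 - f] gives equality. *)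
Lemma har_kernel_fc k : orbit_kernel k -> fc_mod har_kernel k -> har_kernel k.
Proof.
move=> Hk fck; split=> // y.
have le f : Y y -> har y f -> forall g, f (k * g)%g <= f g.
  move=> Yy hf g; have [B fB] : bnd f by case: hf.
  have := @har_kernel_fc_sup k B Hk fck _ _ (g^-1)%g (Yact g^-1%g Yy) (har_shift g hf).
  by rewrite !gnorm; apply.
move=> f Yy hf g; apply/eqP; rewrite eq_le le//=.
have := le _ Yy (harB (har_cst y 0) hf) g; lra.
Qed.

Hypothesis hG : forall N : set G, normal_subgroup N -> fc_closed N -> N = setT.

Lemma har_constant f : har x0 f -> forall g, f g = f 1%g.
Proof.
move=> hf; have Y0 : Y x0 by exists 1%g; rewrite ?act1.
have [T [D DP]] := orbit_kernel_index.
have kerP : orbit_kernel `<=` har_kernel.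
  apply: (fc_closed_finite_index hG orbit_kernel_normal har_kernel_normal _ DP).
    by move=> k [].
  exact: har_kernel_fc.
(* [D] separates left cosets while the kernel acts on the left of the argument, hence the
   inverses. *)
have fD s t : D (s^-1)%g = D (t^-1)%g -> f s = f t.
  move=> /DP/kerP[_ /(_ x0 f Y0 hf t)].
  by rewrite !gnorm.
pose rep c := xget 1%g [set t | D (t^-1)%g = c].
have fE g : f g = f (rep (D g^-1%g)).
  by apply: fD; rewrite /rep; case: xgetP => [u _ ->//|/(_ g)/(_ erefl)].
have [c cmax] : exists c, forall c', f (rep c') <= f (rep c).
  have := @arg_maxP _ _ T (D 1%g) xpredT (fun c => f (rep c)) isT.
  by case=> c _ cmax; exists c => c'; exact: cmax.
have fmax g : f g <= f (rep c) by rewrite fE.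
suff fc g : f g = f (rep c) by move=> g; rewrite !fc.
(* Maximum principle: the non-negative harmonic function [f (rep c) - f] vanishes at [rep c], so
   Harnack makes it vanish everywhere. *)
have hv := har_shift (rep c) (harB (har_cst x0 (f (rep c))) hf).
have [w w0 wP] := harnack_all (act (rep c)^-1%g x0) ((rep c)^-1 * g)%g.
have := wP _ hv (fun g => _); rewrite /= mulg1 subrr !gnorm => wle.
apply/eqP; rewrite eq_le fmax/= -subr_le0 -(pmulr_rle0 _ w0).
by apply: wle => g'; rewrite subr_ge0.
Qed.

Lemma liouville_finite_orbit : liouville act P x0.
Proof.
move=> F [M FM] hF.
have hg g : markov_op act P F (arrow act x0 g) = F (arrow act x0 g).
  by apply: hF; exact: arrow_fiber.
have FgE g : F (arrow act x0 g) = csum [set: G]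
    (fun h => (p (act g^-1%g x0) h)%:C%C * F (arrow act x0 (g * h)%g)).
  by rewrite -hg /arrow markov_opE// actKV.
have hRe : har x0 (fun g => complex.Re (F (arrow act x0 g))).
  split=> [|g].
    by exists M => g; apply/norm_Re_le/FM; exact: arrow_fiber.
  by rewrite {1}FgE csum_avg.
have hIm : har x0 (fun g => complex.Im (F (arrow act x0 g))).
  split=> [|g].
    by exists M => g; apply/norm_Im_le/FM; exact: arrow_fiber.
  by rewrite {1}FgE csum_avg.
exists (F (arrow act x0 1%g)) => a /(fiber_arrow actP) ->.
have := har_constant hRe a.1; have := har_constant hIm a.1.
by case: (F (arrow act x0 a.1)) => ? ?; case: (F _) => ? ? /= -> ->.
Qed.

End finite_orbits.

(** * Words with simple records *)

Section words.
Variable G : groupType.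
Implicit Types (ls : seq G) (n : nat) (w h : G).

Fixpoint words ls n : seq G :=
  if n is m.+1 then words ls m ++ [seq (w * h)%g | w <- words ls m, h <- ls]
  else [:: 1%g].

Lemma words1 ls n : 1%g \in words ls n.
Proof. by elim: n => [|n IH]; rewrite ?inE// mem_cat IH. Qed.

Lemma words_step ls n w h : w \in words ls n -> h \in ls -> (w * h)%g \in words ls n.+1.
Proof.
move=> wn hl; rewrite mem_cat; apply/orP; right.
by apply/allpairsP; exists (w, h).
Qed.

Lemma words_subset ls ls' n n' : {subset ls <= ls'} -> (n <= n')%N ->
  {subset words ls n <= words ls' n'}.
Proof.
move=> sub /subnK <-; elim: (n' - n)%N => [|k IH] w wn; last first.
  by rewrite addSn mem_cat IH.
rewrite add0n; elim: n w wn => [|n IH] w //=.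
rewrite mem_cat => /orP[/IH wn|/allpairsP[[v h] /= [/IH vn hl ->]]].
  by rewrite mem_cat wn.
by apply: words_step => //; exact: sub.
Qed.

End words.

(* Letters of level [j] are [rec j] and [trash j]; [rec j] is chosen after all
   the letters of lower level so as to separate the words of length at most
   [B j] in these. *)
Section records.
Variables (G : groupType) (N : set G) (a : G).
Hypotheses (nN : normal_subgroup N) (cN : fc_closed N) (aN : ~ N a).
Variables (trash : nat -> G) (B : nat -> nat).
Hypothesis Blt : forall i j, (i < j)%N -> (B i < B j)%N.

(** Up to the factor [a] and modulo [N], a word through [g] is never a word of [V], and two words
    through [g] can agree only if their prefixes before [g] do. The class of a word thus remembers
    its record and what came before it. *)
Definition separates (V : seq G) (g : G) : Prop :=
  [/\ forall w1 w2 v1 v2, w1 \in V -> w2 \in V -> v1 \in V -> v2 \in V ->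
        N ((w1 * g * w2)^-1 * (a * (v1 * g * v2)))%g -> N (w1^-1 * (a * v1))%g,
      forall w v1 v2, w \in V -> v1 \in V -> v2 \in V ->
        ~ N (w^-1 * (a * (v1 * g * v2)))%g
    & forall w v1 v2, w \in V -> v1 \in V -> v2 \in V ->
        ~ N ((v1 * g * v2)^-1 * (a * w))%g].

Lemma separates_exists V : exists g, separates V g.
Proof.
(* The first two blocks hold the pairs [x], [y] of the cancellation clause; the last two list the
   values of [g] modulo [N] that would violate the other clauses. *)
pose S := [seq (w * v^-1)%g | w <- V, v <- V] ++
  [seq (v^-1 * a^-1 * w)%g | w <- V, v <- V] ++
  [seq (b * v2^-1)%g | b <- [seq (v1^-1 * a^-1 * w)%g | v1 <- V, w <- V], v2 <- V] ++
  [seq (b * v2^-1)%g | b <- [seq (v1^-1 * a * w)%g | v1 <- V, w <- V], v2 <- V].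
have [g [sw nov]] := switching S nN cN aN; exists g; split.
- move=> w1 w2 v1 v2 w1V w2V v1V v2V Nw.
  have xS : (v2 * w2^-1)%g \in S.
    by rewrite mem_cat; apply/orP; left; apply/allpairsP; exists (v2, w2).
  have yS : (v1^-1 * a^-1 * w1)%g \in S.
    by rewrite !mem_cat; apply/or4P/Or42/allpairsP; exists (w1, v1).
  have Nyx : N ((v1^-1 * a^-1 * w1)^-1 * (g * (v2 * w2^-1) * g^-1))%g.
    by have := nsubJ (g * w2)%g nN Nw; rewrite !gnorm.
  have Nx := sw _ _ xS yS Nyx.
  have := nsubM nN Nyx (nsubV nN (nsubJ g nN Nx)).
  by rewrite !gnorm.
- move=> w v1 v2 wV v1V v2V Nw.
  apply: (nov (v1^-1 * a^-1 * w * v2^-1)%g).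
    rewrite !mem_cat; apply/or4P/Or43/allpairsP.
    exists (v1^-1 * a^-1 * w, v2)%g; split=> //=.
    by apply/allpairsP; exists (v1, w).
  by have := nsubJ v2 nN Nw; rewrite !gnorm.
- move=> w v1 v2 wV v1V v2V Nw.
  apply: (nov (v1^-1 * a * w * v2^-1)%g).
    rewrite !mem_cat; apply/or4P/Or44/allpairsP.
    exists (v1^-1 * a * w, v2)%g; split=> //=.
    by apply/allpairsP; exists (v1, w).
  by have := nsubJ v2 nN (nsubV nN Nw); rewrite !gnorm.
Qed.

Definition separator (V : seq G) : G := sval (cid (separates_exists V)).

(** Each record depends on all earlier ones, so the recursion carries the whole list; the entry
    added last in [recs j.+1] is [rec j]. *)
Fixpoint recs (j : nat) : seq G :=
  if j is i.+1 then
    rcons (recs i) (separator (words (recs i ++ map trash (iota 0 i)) (B i)))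
  else [::].

Definition letters (j : nat) : seq G := recs j ++ map trash (iota 0 j).
Definition rec (j : nat) : G := separator (words (letters j) (B j)).

Lemma recP j : separates (words (letters j) (B j)) (rec j).
Proof. exact: svalP (cid _). Qed.

Lemma recs_rec i j : (i < j)%N -> rec i \in recs j.
Proof.
elim: j => // j IH; rewrite ltnS leq_eqVlt => /predU1P[->|/IH].
  by rewrite /= mem_rcons inE eqxx.
by rewrite /= mem_rcons inE orbC => ->.
Qed.

Lemma recsP j h : h \in recs j -> exists2 i, (i < j)%N & h = rec i.
Proof.
elim: j => // j IH; rewrite mem_rcons inE => /predU1P[->|/IH[i ij ->]].
  by exists j.
by exists i => //; rewrite ltnW.
Qed.

Lemma letters_level i j h : (i < j)%N -> h \in [:: rec i; trash i] -> h \in letters j.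
Proof.
move=> ij; rewrite !inE mem_cat => /orP[/eqP ->|/eqP ->]; first by rewrite recs_rec.
by rewrite map_f ?orbT// mem_iota.
Qed.

Lemma letters_subset i j : (i <= j)%N -> {subset letters i <= letters j}.
Proof.
move=> ij h; rewrite mem_cat => /orP[/recsP[k ki ->]|/mapP[k + ->]].
  by apply: (letters_level (leq_trans ki ij)); rewrite inE eqxx.
rewrite mem_iota => /andP[_ ki].
by apply: (letters_level (leq_trans ki ij)); rewrite !inE eqxx orbT.
Qed.

(* [good s n w]: [w] is the product of [n] letters all of whose records are
   strict and consist of letters [rec j], the last record being at level [s];
   level [0] stands for the absence of a record. *)
Inductive good : nat -> nat -> G -> Prop :=
| good_nil : good 0 0 1%g
| good_low s n w j h : good s n w -> (j < s)%N -> h \in [:: rec j; trash j] ->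
    (n < B s)%N -> good s n.+1 (w * h)%g
| good_rec s n w j : good s n w -> (s < j)%N -> (n < B j)%N ->
    good j n.+1 (w * rec j)%g.

Lemma good_words s n w : good s n w ->
  (n <= B s)%N /\ w \in words (letters s.+1) n.
Proof.
elim=> {s n w} [|s n w j h _ [nB wW] js hj nBs|s n w j _ [nB wW] sj nBj].
- by split; rewrite ?inE.
- split=> //; apply: words_step => //.
  by apply: letters_level hj; exact: ltnW.
- split=> //; apply: words_step.
    by apply: words_subset wW => //; apply: letters_subset; exact: ltnW.
  by apply: (@letters_level j) => //; rewrite inE eqxx.
Qed.

Lemma good_lt s n w j : good s n w -> (s < j)%N -> w \in words (letters j) (B j).
Proof.
move=> /good_words[nB wW] sj; apply: words_subset wW; first exact: letters_subset.
by rewrite (leq_trans nB)// ltnW// Blt.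
Qed.

(** Records are strict, so the last one occurs once: it follows a good word of lower level and is
    followed by lower letters only. *)
Lemma good_split s n w : good s n w -> (0 < s)%N ->
  exists s' n' w1 w2, [/\ (s' < s)%N, good s' n' w1, w2 \in words (letters s) (B s)
    & w = (w1 * rec s * w2)%g].
Proof.
move=> gw s0; suff [s' [n' [w1 [w2 [ss gw1 w2W ->]]]]] : exists s' n' w1 w2,
    [/\ (s' < s)%N, good s' n' w1, w2 \in words (letters s) n & w = (w1 * rec s * w2)%g].
  exists s', n', w1, w2; split=> //; apply: words_subset w2W => //.
  by have [] := good_words gw.
elim: gw s0 => {s n w} [//|s n w j h _ IH js hj nB /IH|s n w j gw _ sj nB _].
  move=> [s' [n' [w1 [w2 [ss gw1 w2W ->]]]]]; exists s', n', w1, (w2 * h)%g.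
  split=> //; last by rewrite !mulgA.
  by apply: words_step => //; exact: letters_level hj.
by exists s, n, w, 1%g; split; rewrite ?words1 ?mulg1.
Qed.

Lemma good0 n w : good 0 n w -> w = 1%g.
Proof.
move=> gw; move e : 0%N gw => s gw; move: e.
by case: gw => // [s' n' w' j h _ js _ _ e|s' n' w' j _ sj _ e];
  [move: js|move: sj]; rewrite -e.
Qed.

(** Induction on the two record levels. If they differ, the switching element of the higher word
    cannot occur in the lower one. If they agree, cancelling the last record leaves the prefixes,
    and at level 0 both words are trivial while [a] is not in [N]. *)
Lemma good_disjoint s n w s' n' w' : good s n w -> good s' n' w' ->
  ~ N (w^-1 * (a * w'))%g.
Proof.
move: {2}(s + s').+1 (ltnSn (s + s')) => m.
elim: m s n w s' n' w' => // m IH s n w s' n' w' ssm gw gw' Nw.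
have [ss'|s's|e] := ltngtP s s'.
- have [|t [k [w1 [w2 [ts' gw1 w2W w'E]]]]] := good_split gw'.
    exact: leq_trans ss'.
  have [_ + _] := recP s'; apply; first exact: (good_lt gw ss').
  + exact: (good_lt gw1 ts').
  + exact: w2W.
  + by rewrite -w'E.
- have [|t [k [w1 [w2 [ts gw1 w2W wE]]]]] := good_split gw.
    exact: leq_trans s's.
  have [_ _] := recP s; apply; first exact: (good_lt gw' s's).
  + exact: (good_lt gw1 ts).
  + exact: w2W.
  + by rewrite -wE.
- subst s'; have [s0|s0] := posnP s.
    subst s; move: Nw; rewrite (good0 gw) (good0 gw') invg1 mul1g mulg1.
    exact: aN.
  have [t [k [w1 [w2 [ts gw1 w2W wE]]]]] := good_split gw s0.
  have [t' [k' [v1 [v2 [ts' gv1 v2W w'E]]]]] := good_split gw' s0.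
  have [sw _ _] := recP s.
  apply: (IH _ _ _ _ _ _ _ gw1 gv1).
    by rewrite -(ltn_add2r 1) !addn1 (leq_trans _ ssm)// ltnS; lia.
  apply: (sw _ w2 _ v2) => //; [exact: (good_lt gw1)|exact: (good_lt gv1)|].
  by rewrite -wE -w'E.
Qed.

End records.

Lemma esum_nat_bool (R : realType) (f : nat * bool -> \bar R) :
  (forall i, 0 <= f i)%E ->
  (\esum_(i in [set: nat * bool]) f i = \sum_(j <oo) (f (j, true) + f (j, false)))%E.
Proof.
move=> f0; rewrite nneseries_esumT; last by move=> j; rewrite adde_ge0.
transitivity (\esum_(j in [set: nat]) \esum_(b in [set: bool]) f (j, b))%E.
  rewrite esum_esum//; congr esum; last by apply/funext => -[].
  by apply/seteqP; split.
apply: eq_esum => j _; rewrite (esumID [set true])// !setTI; congr (_ + _)%E.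
  by rewrite esum_set1.
rewrite (_ : ~` [set true] = [set false]); first by rewrite esum_set1.
by apply/seteqP; split=> -[] // /(_ erefl).
Qed.

(** * Heavy-tailed weights on the levels *)
Section levels.
Variable R : realType.

Definition lev (j : nat) : R := j%:R + 16.

Lemma lev_ge16 j : 16 <= lev j.
Proof. by rewrite /lev lerDr. Qed.

Lemma levS j : lev j.+1 = lev j + 1.
Proof. by rewrite /lev -natr1; ring. Qed.

Lemma lev_div_ge0 c j : 0 <= c -> 0 <= c / lev j.
Proof. by move=> c0; rewrite divr_ge0// (le_trans _ (lev_ge16 j)). Qed.

(** The mass of the levels above [j]. The numerator is [lev 0], which makes the total mass 1; the
    shift 16 also keeps the initial loss [4 / lev 0] at 1 / 4. *)
Definition tail (j : nat) : R := 16 / lev j.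

Definition level_mass (j : nat) : R := if j is i.+1 then tail i - tail i.+1 else 0.

Lemma level_massE i : level_mass i.+1 = 16 / (lev i * (lev i + 1)).
Proof.
rewrite /level_mass /tail levS; have := lev_ge16 i => h.
by field; apply/andP; split; apply: lt0r_neq0; lra.
Qed.

Lemma level_mass_ge0 j : 0 <= level_mass j.
Proof.
case: j => // i; rewrite level_massE; have := lev_ge16 i => h.
by rewrite divr_ge0// mulr_ge0//; lra.
Qed.

Lemma level_mass_gt0 j : 0 < level_mass j.+1.
Proof.
rewrite level_massE; have := lev_ge16 j => h.
by rewrite divr_gt0// mulr_gt0//; lra.
Qed.

Lemma level_mass_sum n : \sum_(j < n.+1) level_mass j = 1 - tail n.
Proof.
elim: n => [|n IH]; first by rewrite big_ord_recr big_ord0 /= /tail /lev add0r add0r divff ?subrr.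
by rewrite big_ord_recr IH /=; ring.
Qed.

Lemma tail_cvg : tail n @[n --> \oo] --> (0 : R).
Proof.
have -> : tail = (fun n => 16 * harmonic (n + 15)%N).
  apply/funext => n; rewrite /tail /lev /harmonic /=.
  by congr (_ / _); rewrite -natrD; congr (_%:R); lia.
suff : 16 * harmonic (n + 15)%N @[n --> \oo] --> (16 * 0 : R) by rewrite mulr0.
apply: cvgM; first exact: cvg_cst.
by rewrite (cvg_shiftn 15 (@harmonic R)); exact: cvg_harmonic.
Qed.

Lemma level_mass_cvg : \sum_(j < n) level_mass j @[n --> \oo] --> (1 : R).
Proof.
rewrite -cvg_shiftS (_ : (fun n => _) = fun n => 1 - tail n).
  have : 1 - tail n @[n --> \oo] --> (1 - 0 : R).
    by apply: cvgB tail_cvg; exact: cvg_cst.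
  by rewrite subr0.
by apply/funext => n /=; rewrite level_mass_sum.
Qed.

(** The boolean chooses between record letter and trash letter. Trash has the vanishing share 1 /
    [lev j]: enough to charge every group element, and cheap enough to be counted as failure when it
    would set a record. *)
Definition branch_mass (i : nat * bool) : R :=
  level_mass i.1 * (if i.2 then 1 - (lev i.1)^-1 else (lev i.1)^-1).

Lemma lev_inv j : 0 < (lev j)^-1 <= 1 / 16.
Proof.
have h := lev_ge16 j; rewrite invr_gt0 (lt_le_trans _ h)//=.
by rewrite div1r lef_pV2// posrE// (lt_le_trans _ h).
Qed.

Lemma branch_mass_ge0 i : 0 <= branch_mass i.
Proof.
rewrite /branch_mass mulr_ge0 ?level_mass_ge0//.
by have /andP[? ?] := lev_inv i.1; case: ifP => _; lra.
Qed.

Lemma branch_mass_gt0 j b : 0 < branch_mass (j.+1, b).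
Proof.
rewrite /branch_mass mulr_gt0 ?level_mass_gt0//=.
by have /andP[? ?] := lev_inv j.+1; case: b; lra.
Qed.

Lemma branch_mass_prob : prob_mass [set: nat * bool] branch_mass.
Proof.
split=> [i _|]; first exact: branch_mass_ge0.
rewrite esum_nat_bool; last by move=> i; rewrite lee_fin branch_mass_ge0.
rewrite (_ : (fun n => _) = fun n => (\sum_(j < n) level_mass j)%:E).
  by apply/cvg_lim => //; apply: cvg_EFin; [exact: nearW|exact: level_mass_cvg].
apply/funext => n; rewrite big_mkord -sumEFin; apply: eq_bigr => j _.
by rewrite -EFinD /branch_mass /=; congr EFin; ring.
Qed.

(* Survival time needed at level [j]: below [j] the chain stays with
   probability [1 - tail j.-1] at each step. *)
Fixpoint budget (j : nat) : nat :=
  if j is i.+1 then (budget i + 1 + (i + 17) ^ 2)%N else 1.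

Lemma budget_step i j : (i < j)%N -> (budget i + 1 + (j + 16) ^ 2 <= budget j)%N.
Proof.
elim: j => // j IH; rewrite ltnS leq_eqVlt => /predU1P[->|/IH] /=.
  by rewrite (_ : j.+1 + 16 = j + 17)%N; last lia.
move=> h; rewrite (_ : j.+1 + 16 = j + 17)%N; last lia.
by rewrite leq_add2r leq_add2r; lia.
Qed.

Lemma budget_lt i j : (i < j)%N -> (budget i < budget j)%N.
Proof. by move=> /budget_step; lia. Qed.

Definition stay (j : nat) : R := \sum_(i < j) level_mass i.

Lemma stay_bounds j : 0 <= stay j <= 1.
Proof.
rewrite /stay; case: j => [|j]; first by rewrite big_ord0 lexx ler01.
rewrite level_mass_sum /tail; have h := lev_ge16 j.
have : 0 <= 16 / lev j <= 1.
  by rewrite divr_ge0 ?ler_pdivrMr ?mul1r//; lra.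
by move=> /andP[? ?]; apply/andP; split; lra.
Qed.

Lemma bernoulli_pow (t : R) k : 0 <= t <= 1 -> (1 - t) ^+ k * (1 + k%:R * t) <= 1.
Proof.
move=> /andP[t0 t1]; elim: k => [|k IH]; first by rewrite expr0 mul0r addr0 mul1r.
apply: le_trans IH; rewrite exprSr -mulrA ler_wpM2l ?exprn_ge0 ?subr_ge0//.
rewrite -natr1; have : 0 <= (k%:R + 1) * (t * t) by rewrite mulr_ge0 ?mulr_ge0// addr_ge0.
by lra.
Qed.

(** A new record has probability of order 1 / [lev j] at each step, so waiting [lev j ^+ 2] steps
    leaves, by Bernoulli's inequality, at most 1 / [lev j] for its absence. *)
Lemma stay_pow j k : (0 < j)%N -> ((j + 16) ^ 2 <= k)%N -> stay j ^+ k <= (lev j)^-1.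
Proof.
case: j => // j _ jk.
have /andP[s0 s1] := stay_bounds j.+1.
apply: (le_trans (ler_wiXn2l s0 s1 jk)).
move: s0 s1; rewrite /stay level_mass_sum => s0 s1.
have t01 : 0 <= tail j <= 1 by apply/andP; split; lra.
have := bernoulli_pow ((j.+1 + 16) ^ 2) t01.
have h := lev_ge16 j.
rewrite -[(lev _)^-1]mul1r ler_pdivlMr; last by have := lev_ge16 j.+1; lra.
apply: le_trans; apply: ler_wpM2l; first by rewrite exprn_ge0.
have -> : (((j.+1 + 16) ^ 2)%:R : R) = lev j.+1 ^+ 2 by rewrite natrX /lev natrD.
rewrite levS /tail; set x := lev j in h *.
have : 16 <= (x + 1) ^+ 2 * (16 / x) - 16 * x.
  have -> : (x + 1) ^+ 2 * (16 / x) - 16 * x = 32 + 16 / x.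
    by field; apply: lt0r_neq0; lra.
  have : 0 <= 16 / x by exact: lev_div_ge0.
  lra.
lra.
Qed.

(* Lower bound for the probability that a good word of length [n] with last record
   at level [s] stays good forever. *)
Definition value (s n : nat) : R := 1 - 4 / lev s - stay s ^+ (budget s - n).

(** A telescoping lower bound for the contribution of records above level [j]. Such a record at
    level i loses about 6 / [lev i] (1 for trash, 5 from [value_record]) on a mass of about 16 /
    [lev i ^+ 2]; summed over i > j this is 48 / [lev j ^+ 2], taken off the tail. *)
Definition record_gain (j : nat) : R := 16 / lev j - 48 / lev j ^+ 2.

Lemma record_gain_step j :
  record_gain j - record_gain j.+1 <=
  level_mass j.+1 * ((1 - (lev j.+1)^-1) * (1 - 5 / lev j.+1)).
Proof.
rewrite /record_gain level_massE levS; have h := lev_ge16 j; set x := lev j in h *.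
rewrite -subr_ge0.
have -> : 16 / (x * (x + 1)) * ((1 - (x + 1)^-1) * (1 - 5 / (x + 1))) -
    (16 / x - 48 / x ^+ 2 - (16 / (x + 1) - 48 / (x + 1) ^+ 2)) =
    (48 * (x + 1) + 80 * x) / (x ^+ 2 * (x + 1) ^+ 3).
  field; apply/andP; split; apply: lt0r_neq0; lra.
apply: divr_ge0; first lra.
by apply: mulr_ge0; rewrite exprn_ge0//; lra.
Qed.

(** With c in place of 4 the terms of order 1 / [lev s] cancel, and those of order 1 / [lev s ^+ 2]
    require c >= 4. *)
Lemma value_step s n : (n < budget s)%N ->
  value s n <= stay s * value s n.+1 + record_gain s.
Proof.
move=> nB; rewrite /value.
have -> : (budget s - n = (budget s - n.+1).+1)%N by lia.
rewrite exprS /record_gain.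
suff : (1 - stay s) * (1 - 4 / lev s) <= 16 / lev s - 48 / lev s ^+ 2 by lra.
case: s {nB} => [|s]; first by rewrite /stay big_ord0 /lev add0r; lra.
rewrite /stay level_mass_sum opprB addrC subrK /tail levS.
have h := lev_ge16 s; set x := lev s in h *.
rewrite -subr_ge0.
have -> : 16 / (x + 1) - 48 / (x + 1) ^+ 2 - 16 / x * (1 - 4 / (x + 1)) =
  48 / (x * (x + 1) ^+ 2).
  field; apply/andP; split; apply: lt0r_neq0; lra.
apply: divr_ge0 => //.
by apply: mulr_ge0; rewrite ?exprn_ge0//; lra.
Qed.

Lemma value_le1 s n : value s n <= 1.
Proof.
rewrite /value; have /andP[s0 _] := stay_bounds s; have h := lev_ge16 s.
have : 0 <= 4 / lev s by exact: lev_div_ge0.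
have := exprn_ge0 (budget s - n) s0; lra.
Qed.

Lemma value_record s n j : (s < j)%N -> (n < budget s)%N ->
  1 - 5 / lev j <= value j n.+1.
Proof.
move=> sj nB; have bs := budget_step sj.
rewrite /value.
have : stay j ^+ (budget j - n.+1) <= (lev j)^-1.
  by apply: stay_pow; [exact: leq_ltn_trans sj|lia].
have -> : 5 / lev j = 4 / lev j + (lev j)^-1.
  by field; apply: lt0r_neq0; apply: lt_le_trans (lev_ge16 j).
lra.
Qed.

Lemma value_pos s n : (n <= budget s)%N -> 0 < value s n -> (n < budget s)%N.
Proof.
move=> nB v0; rewrite ltn_neqAle nB andbT; apply/eqP => e.
move: v0; rewrite /value e subnn expr0; have h := lev_ge16 s.
have : 0 <= 4 / lev s by exact: lev_div_ge0.
lra.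
Qed.

End levels.

(** * Choquet--Deny groups have no ICC quotients *)
Section icc_quotient.
Variables (R : realType) (G : groupType) (N : set G) (a : G).
Hypotheses (nN : normal_subgroup N) (cN : fc_closed N) (aN : ~ N a).
Variable e : nat -> G.
Hypothesis eP : forall g, exists n, e n = g.

(** Trash letters enumerate [G], so that [nu] has full support; the predecessor skips level 0, which
    has no mass. *)
Let trash j := e j.-1.
Let record := rec nN cN aN trash budget.
Let good := good nN cN aN trash budget.
Let letter (i : nat * bool) := if i.2 then record i.1 else trash i.1.
Let nu : G -> R := push_mass (@branch_mass R) letter.

Let nuP : prob_mass [set: G] nu.
Proof. exact/prob_mass_push_mass/branch_mass_prob. Qed.

Let nu_gt0 g : 0 < nu g.
Proof.
have [n <-] := eP g.
have := @push_mass_ge _ _ _ _ letter (@branch_mass_prob R) (n.+1, false).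
by apply: lt_le_trans; exact: branch_mass_gt0.
Qed.

Let avg_nu_ge F J : (forall g, 0 <= F g) -> bnd F ->
  \sum_(j < J) level_mass R j *
    ((1 - (lev R j)^-1) * F (record j) + (lev R j)^-1 * F (trash j)) <= avg nu F.
Proof.
move=> F0 bF; rewrite -lee_fin avgE// esum_push_mass//; last exact: branch_mass_prob.
have pos i : (0 <= (branch_mass R i * F (letter i))%:E)%E.
  by rewrite lee_fin mulr_ge0// branch_mass_ge0.
rewrite esum_nat_bool//.
apply: (@le_trans _ _ (\sum_(0 <= j < J) ((branch_mass R (j, true) * F (letter (j, true)))%:E
   + (branch_mass R (j, false) * F (letter (j, false)))%:E))%E).
  rewrite big_mkord -sumEFin le_eqVlt; apply/orP; left; apply/eqP.
  by apply: eq_bigr => j _; rewrite -EFinD /branch_mass /=; congr EFin; ring.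
by apply: nneseries_lim_ge => j _; rewrite adde_ge0.
Qed.

(** An element may be good for several pairs [(s, n)]; the supremum avoids a choice, and 0 covers
    the elements that are never good. *)
Let u (z : G) : R :=
  sup ([set 0] `|` [set r | exists s n, good s n z /\ r = value R s n]).

Let u_has_sup z :
  has_sup ([set 0] `|` [set r | exists s n, good s n z /\ r = value R s n]).
Proof.
split; first by exists 0; left.
by exists 1 => _ [->|[s [n [_ ->]]]]; [exact: ler01|exact: value_le1].
Qed.

Let u_ge0 z : 0 <= u z.
Proof. by apply: ub_le_sup; [case: (u_has_sup z)|left]. Qed.

Let u_ge s n z : good s n z -> value R s n <= u z.
Proof. by move=> gz; apply: ub_le_sup; [case: (u_has_sup z)|right; exists s, n]. Qed.

Let u_le z r : 0 <= r -> (forall s n, good s n z -> value R s n <= r) -> u z <= r.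
Proof.
move=> r0 h; apply: ge_sup; first by case: (u_has_sup z).
by move=> _ [->|[s [n [gz ->]]]] //; exact: h.
Qed.

Let u01 z : 0 <= u z <= 1.
Proof. by rewrite u_ge0 u_le// => s n _; exact: value_le1. Qed.

(** Split the next letter by its level. Below [s] either letter keeps the record, at [s] the
    contribution is dropped, above [s] only the record letter counts, and [value_step] balances the
    three. Partial sums miss only [record_gain (s + k)], which tends to 0. *)
Let u_subharmonic z : u z <= avg nu (fun h => u (z * h)%g).
Proof.
have b : bnd (fun h => u (z * h)%g) by apply: bnd01 => h; exact: u01.
have Q0 : 0 <= avg nu (fun h => u (z * h)%g) by apply: (avg_ge0 nuP) => h; exact: u_ge0.
apply: u_le => // s n gz.
have [v0|v0] := leP (value R s n) 0; first exact: le_trans Q0.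
have nB : (n < budget s)%N by apply: value_pos v0; case: (good_words gz).
set Q := avg _ _ in Q0 *.
pose term j := level_mass R j *
  ((1 - (lev R j)^-1) * u (z * record j)%g + (lev R j)^-1 * u (z * trash j)%g).
have termJ J : \sum_(j < J) term j <= Q by exact: avg_nu_ge.
have term_low j : (j < s)%N -> level_mass R j * value R s n.+1 <= term j.
  move=> js; rewrite /term ler_wpM2l ?level_mass_ge0//.
  have u1 : value R s n.+1 <= u (z * record j)%g.
    by apply/u_ge/(good_low gz js); rewrite ?inE ?eqxx.
  have u2 : value R s n.+1 <= u (z * trash j)%g.
    by apply/u_ge/(good_low gz js); rewrite ?inE ?eqxx ?orbT.
  have /andP[l0 l1] := lev_inv R j; set l := (lev R j)^-1 in l0 l1 *.
  have := ler_wpM2l (ltW l0) u2.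
  have : (1 - l) * value R s n.+1 <= (1 - l) * u (z * record j)%g.
    by apply: ler_wpM2l => //; lra.
  lra.
have term_high j : (s <= j)%N -> record_gain R j - record_gain R j.+1 <= term j.+1.
  move=> sj; apply: (le_trans (record_gain_step R j)).
  rewrite /term ler_wpM2l ?level_mass_ge0//.
  have /andP[l0 l1] := lev_inv R j.+1.
  apply: (@le_trans _ _ ((1 - (lev R j.+1)^-1) * u (z * record j.+1)%g)).
    apply: ler_wpM2l; first lra.
    apply: (le_trans (@value_record R s n j.+1 sj nB)).
    by apply/u_ge/(good_rec gz) => //; apply: ltn_trans nB _; exact: budget_lt.
  by rewrite lerDl mulr_ge0// ltW.
have term_ge0 j : 0 <= term j.
  have /andP[l0 l1] := lev_inv R j.
  rewrite /term mulr_ge0 ?level_mass_ge0// addr_ge0// mulr_ge0//; lra.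
have sum_low : stay R s * value R s n.+1 <= \sum_(j < s) term j.
  by rewrite /stay mulr_suml; apply: ler_sum => j _; exact: term_low.
have sum_high k : stay R s * value R s n.+1 + record_gain R s - record_gain R (s + k)
    <= \sum_(j < (s + k).+1) term j.
  elim: k => [|k IH].
    by rewrite addn0 addrK big_ord_recr /=; have := term_ge0 s; lra.
  rewrite addnS big_ord_recr /=.
  by have := term_high (s + k)%N (leq_addr _ _); lra.
apply/ler_addgt0Pr => eps eps0.
have [k kE] : exists k : nat, record_gain R (s + k) <= eps.
  exists (Num.trunc (16 / eps)).+1; rewrite /record_gain.
  set m := (s + _)%N; have h := lev_ge16 R m.
  have : 16 / lev R m <= eps.
    rewrite ler_pdivrMr; last by lra.
    rewrite mulrC -ler_pdivrMr// (le_trans (ltW (truncnS_gt _)))//.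
    by rewrite /lev /m natrD; have : (0 : R) <= s%:R by []; lra.
  have : 0 <= 48 / lev R m ^+ 2 by rewrite divr_ge0// exprn_ge0//; lra.
  lra.
have := value_step R nB; have := sum_high k; have := termJ (s + k).+1.
lra.
Qed.

Let v z := u (a^-1 * z)%g.

Let uv z : u z + v z <= 1.
Proof.
have [[s [n gz]]|no] := pselect (exists s n, good s n z).
  suff -> : v z = 0 by rewrite addr0; case/andP: (u01 z).
  apply/eqP; rewrite eq_le u_ge0 andbT; apply: u_le => // s' n' gz'.
  case: (good_disjoint budget_lt gz gz').
  by rewrite !gnorm; exact: nsub1.
suff -> : u z = 0 by rewrite add0r; case/andP: (u01 (a^-1 * z)%g).
apply/eqP; rewrite eq_le u_ge0 andbT; apply: u_le => // s n gz.
by exfalso; apply: no; exists s, n.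
Qed.

Let u1 : 3 / 4 <= u 1%g.
Proof.
apply: le_trans (u_ge (good_nil _ _ _ _ _)).
by rewrite /value /stay big_ord0 /= expr1 /lev add0r; lra.
Qed.

Let v_subharmonic z : v z <= avg nu (fun h => v (z * h)%g).
Proof.
apply: le_trans (u_subharmonic _) _; rewrite le_eqVlt; apply/orP; left; apply/eqP.
by apply: eq_avg => h; rewrite /v mulgA.
Qed.

Lemma not_group_choquet_deny : ~ group_choquet_deny R G.
Proof.
move=> CD.
have [F [F01 uF Fv FQ]] := harmonic_between (w := fun=> nu) (nx := fun z h => (z * h)%g)
  (fun=> nuP) u_ge0 (fun z => u_ge0 _) uv u_subharmonic v_subharmonic.
have gen : generated_semigroup [set g | 0 < nu g] = [set: G].
  apply/seteqP; split=> // g _ M [_]; apply; exact: nu_gt0.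
have [|g|c Fc] := CD nu nuP gen (fun g => (F g)%:C%C).
- exists 1 => g _; rewrite norm_real_complex lecR.
  by have /andP[F0 F1] := F01 g; rewrite ger0_norm.
- by rewrite csum_avg_real {1}FQ.
(* [F] is at least 3 / 4 at the identity and at most 1 / 4 at [a]. *)
have := Fc a I; rewrite -(Fc 1%g I) => -[Fa].
have := uF 1%g; have := Fv a; rewrite /v mulVg; have := u1; lra.
Qed.

End icc_quotient.

Lemma fc_closed_choquet_deny (R : realType) (G : groupType) :
  countable [set: G] -> group_choquet_deny R G ->
  forall N : set G, normal_subgroup N -> fc_closed N -> N = setT.
Proof.
move=> cG CD N nN cN; apply/seteqP; split=> // a _.
apply: contrapT => aN; have [e eP] := countable_enum (1%g : G) cG.
exact: (not_group_choquet_deny nN cN aN eP CD).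
Qed.

(** * Markers for infinite orbits *)

Lemma standard_borel_separating (R : realType) (d : measure_display)
    (X : measurableType d) : standard_borel R X ->
  exists U : nat -> set X, (forall n, measurable (U n)) /\
    forall x y, x <> y -> exists n, U n x /\ ~ U n y.
Proof.
move=> [T [_ [D cD dD] [f fbij fB]]].
have [i iD] := countable_injP _ cD.
have finj := bij_inj fbij.
pose V (nk : nat * nat) : set T :=
  \bigcup_(c in [set c | D c /\ i c = nk.1]) interior (ball c (nk.2.+1%:R^-1 : R)).
pose U n := if unpickle n is Some nk then f @^-1` (V nk) else set0.
exists U; split=> [n|x y xy].
  rewrite /U; case: unpickle => [nk|]; last exact: measurable0.
  apply/fB; have -> : f @` (f @^-1` V nk) = V nk.
    apply: image_preimage; apply/seteqP; split=> // t _.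
    by have [g _ gK] := fbij; exists (g t).
  apply: sub_sigma_algebra; apply: bigcup_open => c _; exact: open_interior.
have fxy : mdist (f x) (f y) != 0.
  by apply/eqP => /mdist_positivity/finj.
have d0 : 0 < mdist (f x) (f y) by rewrite lt_neqAle eq_sym fxy mdist_ge0.
have [k kd] : exists k : nat, k.+1%:R^-1 < mdist (f x) (f y) / 2.
  exists (Num.trunc (2 / mdist (f x) (f y))).
  rewrite invf_plt ?posrE ?divr_gt0// invf_div; exact: truncnS_gt.
have k0 : 0 < (k.+1%:R^-1 : R) by rewrite invr_gt0.
(* With [c] within half the radius of [f x], a ball around [f x] fits into that of [c], which puts
   [f x] in the interior. *)
have [c [cB Dc]] : (interior (ball (f x) (k.+1%:R^-1 / 2 : R))) `&` D !=set0.
  apply: dD; last exact: open_interior.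
  by exists (f x); apply: nbhsx_ballx; rewrite divr_gt0.
exists (pickle (i c, k)); rewrite /U pickleK; split.
  exists c => //=; apply/nbhs_ballP; exists (k.+1%:R^-1 / 2) => /=.
    by rewrite divr_gt0.
  move=> z fxz; apply: le_ball (ball_triangle (ball_sym (interior_subset cB)) fxz).
  by rewrite -splitr.
move=> [c' [Dc' ic'] /interior_subset cy].
have {c' Dc' ic' cy} cy : ball c (k.+1%:R^-1 : R) (f y).
  by have <- : c' = c by apply: iD; rewrite ?inE.
have := ball_triangle (interior_subset cB) cy.
rewrite ballEmdist /= ltNge => /negP; apply.
by move: k0 kd; set r := (k.+1%:R^-1 : R); lra.
Qed.

Section markers.
Variables (G : groupType) (d : measure_display) (X : measurableType d).
Variables (act : G -> X -> X) (e : nat -> G) (U : nat -> set X).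
Hypothesis actP : is_action act.
Hypothesis mact : forall g, measurable_fun [set: X] (act g).
Hypothesis eP : forall g, exists n, e n = g.
Hypothesis mU : forall n, measurable (U n).
Hypothesis sepU : forall x y, x <> y -> exists n, U n x /\ ~ U n y.

Let act1 x : act 1%g x = x. Proof. by case: actP. Qed.
Let actM g h x : act (g * h)%g x = act g (act h x). Proof. by case: actP. Qed.

Let mpre g (C : set X) : measurable C -> measurable [set x | C (act g x)].
Proof. by move=> mC; rewrite -[X in measurable X]setTI; exact: mact. Qed.

Lemma orbit_of_act g x : orbit_of act (act g x) = orbit_of act x.
Proof.
apply/seteqP; split=> _ [h _ <-].
  by exists (h * g)%g; rewrite ?actM.
by exists (h * g^-1)%g => //; rewrite -actM !gnorm.
Qed.

Definition inf_often (C : set X) : set X :=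
  [set x | infinite_set (orbit_of act x `&` C)].

Lemma inf_often_act C g x : inf_often C (act g x) <-> inf_often C x.
Proof. by rewrite /inf_often /= orbit_of_act. Qed.

(** Infinitely many points means: for every m, one that differs from the first m points of the
    enumerated orbit. Testing inequality with the sets [U n] keeps all operations countable, hence
    measurable. *)
Lemma inf_oftenE C : inf_often C = \bigcap_m \bigcup_k
  ([set x | C (act (e k) x)] `&`
   \bigcap_(i in `I_m) \bigcup_n ([set x | U n (act (e k) x)] `\`
                                  [set x | U n (act (e i) x)])).
Proof.
apply/seteqP; split=> x.
  move=> infC m _; apply: contrapT => no.
  apply: infC; apply: (@sub_finite_set _ _ [set act (e i) x | i in `I_m]).
    move=> _ [[g _ <-] Cg]; have [k kg] := eP g; apply: contrapT => nim; apply: no.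
    exists k => //=; rewrite kg; split=> // i im.
    have /sepU[n [Un1 Un2]] : act g x <> act (e i) x.
      by move=> E; apply: nim; exists i.
    by exists n.
  by apply: finite_image; exact: finite_II.
move=> h /finite_seqP[s sE].
pose idx y := xget 0%N [set k | act (e k) x = y].
have [k _ [Ck kP]] := h (\max_(y <- s) idx y).+1 I.
have : (orbit_of act x `&` C) (act (e k) x) by split=> //; exists (e k).
rewrite sE /= => ks.
have [] := kP (idx (act (e k) x)).
  by rewrite /= ltnS; exact: leq_bigmax_seq.
move=> n _ [/=]; rewrite /idx.
have -> : act (e (xget 0%N [set k0 | act (e k0) x = act (e k) x])) x = act (e k) x.
  exact: (@xgetPex _ 0%N [set k0 | act (e k0) x = act (e k) x] (ex_intro _ k erefl)).
by move=> ? [].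
Qed.

Lemma measurable_inf_often C : measurable C -> measurable (inf_often C).
Proof.
move=> mC; rewrite inf_oftenE; apply: bigcapT_measurable => m.
apply: bigcupT_measurable => k; apply: measurableI; first exact: mpre.
apply: bigcap_measurableType => i _; apply: bigcupT_measurable => n.
by apply: measurableD; exact: mpre.
Qed.

(* Slaman--Steel: keep the half of the previous marker selected by the
   lexicographically least branch along which the orbit accumulates. *)
Fixpoint marker (n : nat) : set X :=
  if n is m.+1 then
    marker m `&` [set x | U m x <-> inf_often (marker m `&` U m) x]
  else [set: X].

Lemma measurable_marker n : measurable (marker n).
Proof.
elim: n => [|n IH] /=; first exact: measurableT.
apply: measurableI => //.
have mI : measurable (inf_often (marker n `&` U n)).
  by apply: measurable_inf_often; exact: measurableI.
rewrite (_ : [set x | _] = (U n `&` inf_often (marker n `&` U n)) `|`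
   (~` U n `&` ~` inf_often (marker n `&` U n))).
  apply: measurableU; first exact: measurableI.
  by apply: measurableI; exact: measurableC.
apply/seteqP; split=> x /=.
  by move=> [h1 h2]; have [Ux|Ux] := pselect (U n x); [left|right]; tauto.
by tauto.
Qed.

Lemma marker_inf n x : infinite_set (orbit_of act x) -> inf_often (marker n) x.
Proof.
move=> infx; elim: n => [|n IH]; first by rewrite /inf_often /= setIT.
have orbI y : orbit_of act x y ->
    inf_often (marker n `&` U n) y <-> inf_often (marker n `&` U n) x.
  by move=> [g _ <-]; exact: inf_often_act.
have [hU|hU] := pselect (inf_often (marker n `&` U n) x).
  move=> fin; apply: (hU); apply: sub_finite_set fin => y [Oy [my Uy]].
  by split=> //; split=> //=; split=> // _; apply/orbI.
move=> fin; apply: IH.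
have : finite_set ((orbit_of act x `&` marker n.+1) `|`
    (orbit_of act x `&` (marker n `&` U n))).
  by rewrite finite_setU; split=> //; apply: contrapT.
apply: sub_finite_set => y [Oy my].
have [Uy|Uy] := pselect (U n y); [by right|left].
by split=> //; split=> //=; split=> // /(orbI _ Oy).
Qed.

Lemma marker_sub m n : (m <= n)%N -> marker n `<=` marker m.
Proof.
move=> /subnK <-; elim: (n - m)%N => [//|k IH] x; rewrite addSn => -[+ _].
exact: IH.
Qed.

(** The choice of half is constant on the orbit, so two of its points in [marker n.+1] agree about
    [U n]. *)
Lemma marker_separates y z : orbit_of act y z ->
  (forall n, marker n y) -> (forall n, marker n z) -> y = z.
Proof.
move=> [g _ <-] my mz; apply: contrapT => /sepU[n [Uy Uz]].
have [_ /= h1] := my n.+1; have [_ /= h2] := mz n.+1.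
by apply: Uz; apply/h2/inf_often_act/h1.
Qed.

(** The stage at which a point leaves the markers. At most one point of an orbit never leaves and
    stays unlabelled. *)
Definition label (c : nat) : set X := marker c `\` marker c.+1.

Lemma label_inj c c' x : label c x -> label c' x -> c = c'.
Proof.
move=> [mc nc] [mc' nc']; have [lt|lt|//] := ltngtP c c'.
  by exfalso; apply: nc; apply: marker_sub mc'.
by exfalso; apply: nc'; apply: marker_sub mc.
Qed.

Definition hits (c : nat) : set X := [set x | exists g, label c (act g x)].

Lemma hits_act c g x : hits c (act g x) <-> hits c x.
Proof.
split=> -[h]; first by rewrite -actM; exists (h * g)%g.
by move=> lh; exists (h * g^-1)%g; rewrite -actM !gnorm.
Qed.

Lemma hits_unbounded x m : infinite_set (orbit_of act x) ->
  exists2 c, (m <= c)%N & hits c x.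
Proof.
move=> infx; have infm := @marker_inf m x infx.
have [z [[g _ gz] mz] [n nz]] : exists2 z, (orbit_of act x `&` marker m) z &
    exists n, ~ marker n z.
  apply: contrapT => no; apply: infm.
  have all z : (orbit_of act x `&` marker m) z -> forall n, marker n z.
    move=> Oz n; apply: contrapT => nz; apply: no; exists z => //; by exists n.
  have [->|/set0P[z Oz]] := eqVneq (orbit_of act x `&` marker m) set0.
    exact: finite_set0.
  apply: (sub_finite_set _ (finite_set1 z)) => z' Oz' /=.
  apply: marker_separates; [|exact: all|exact: all].
  case: Oz' => -[g _ <-] _; rewrite orbit_of_act; by case: Oz.
have [k nk kmin] := ex_minnP (ex_intro (fun n => `[< ~ marker n z >]) n (asboolT nz)).
move: nk => /asboolP nk.
have mk : (m < k)%N.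
  by rewrite ltnNge; apply/negP => km; apply: nk; exact: marker_sub mz.
case: k mk nk kmin => // k mk nk kmin; exists k => //; exists g.
rewrite gz; split=> //; apply: contrapT => nk'.
by have := kmin k (asboolT nk'); rewrite ltnn.
Qed.

(** An orbit may miss some labels. Renumbering those it hits gives levels that all meet every
    infinite orbit. *)
Definition rank (l : nat) (x : X) : nat := \sum_(c < l) `[< hits c x >].

Lemma rankS l x : rank l.+1 x = (rank l x + `[< hits l x >])%N.
Proof. by rewrite /rank big_ord_recr. Qed.

Lemma rank_act l g x : rank l (act g x) = rank l x.
Proof.
apply: eq_bigr => c _; congr nat_of_bool.
by apply: asbool_equiv_eq; exact: hits_act.
Qed.

Definition level (n : nat) : set X := [set x | exists2 l, label l x & rank l x = n].

Lemma level_inj n n' x : level n x -> level n' x -> n = n'.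
Proof. by move=> [l lx <-] [l' lx' <-]; rewrite (label_inj lx lx'). Qed.

Lemma level_hit n x : infinite_set (orbit_of act x) -> exists g, level n (act g x).
Proof.
move=> infx.
have [l ln] : exists l, (n < rank l x)%N.
  elim: n => [|n [l ln]].
    have [c _ hc] := hits_unbounded 0 infx; exists c.+1.
    by rewrite rankS (asboolT hc) addn1.
  have [c lc hc] := hits_unbounded l infx; exists c.+1.
  rewrite rankS (asboolT hc) addn1 ltnS (leq_trans ln)//.
  rewrite -(subnK lc); elim: (c - l)%N => [//|k IH].
  by rewrite addSn rankS (leq_trans IH)// leq_addr.
have [k nk kmin] := ex_minnP (ex_intro (fun l => n < rank l x)%N l ln).
case: k nk kmin => [|k]; first by rewrite /rank big_ord0.
move=> nk kmin; have rk : (rank k x <= n)%N.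
  by rewrite leqNgt; apply/negP => /kmin; rewrite ltnn.
move: nk; rewrite rankS.
case: asboolP => [[g lg]|_]; last by rewrite addn0 ltnNge rk.
rewrite /= addn1 ltnS => nk; exists g; exists k => //.
by rewrite rank_act; apply/eqP; rewrite eqn_leq rk.
Qed.

Lemma measurable_label c : measurable (label c).
Proof. by apply: measurableD; exact: measurable_marker. Qed.

Lemma measurable_level n : measurable (level n).
Proof.
have mhits c : measurable (hits c).
  rewrite (_ : hits c = \bigcup_k [set x | label c (act (e k) x)]).
    by apply: bigcupT_measurable => k; apply: mpre; exact: measurable_label.
  apply/seteqP; split=> [x [g lg]|x [k _ lk]]; last by exists (e k).
  by have [k kg] := eP g; exists k => //=; rewrite kg.
have mrank l m : measurable [set x | rank l x = m].
  elim: l m => [|l IH] m.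
    rewrite /rank; under eq_set do rewrite big_ord0.
    by have [<-|m0] := eqVneq 0%N m; [rewrite (_ : [set _ | _] = setT)//; apply/seteqP|
      rewrite (_ : [set _ | _] = set0)//; apply/seteqP; split=> // x /eqP; rewrite (negbTE m0)].
  rewrite (_ : [set x | _] = ([set x | rank l x = m] `\` hits l) `|`
      (hits l `&` [set x | (rank l x).+1 = m])).
    apply: measurableU; first exact: measurableD.
    apply: measurableI => //; case: m => [|m].
      by rewrite (_ : [set _ | _] = set0)//; apply/seteqP; split.
    rewrite (_ : [set _ | _] = [set x | rank l x = m])//.
    by apply/seteqP; split=> x /= => [[]|->].
  apply/seteqP; split=> x /=; rewrite rankS.
    by case: asboolP => hl; rewrite ?addn0 ?addn1 => <-; [right|left].
  by move=> [[<- hl]|[hl <-]]; case: asboolP => // _; rewrite ?addn0 ?addn1.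
rewrite (_ : level n = \bigcup_l (label l `&` [set x | rank l x = n])).
  by apply: bigcupT_measurable => l; apply: measurableI => //; exact: measurable_label.
by apply/seteqP; split=> [x [l lx rx]|x [l _ [lx rx]]]; exists l.
Qed.

End markers.

Lemma measurable_countable_factor (d d' : measure_display) (X : measurableType d)
    (Y : measurableType d') (C : countType) (k : X -> C) (F : C -> Y) :
  (forall c, measurable [set x | k x = c]) -> measurable_fun [set: X] (F \o k).
Proof.
move=> mk _ B _; rewrite setTI.
rewrite (_ : _ @^-1` B = \bigcup_n
    (if unpickle n is Some c then if `[< B (F c) >] then [set x | k x = c] else set0
     else set0)).
  apply: bigcupT_measurable => n.
  by case: unpickle => // c; case: asboolP.
apply/seteqP; split=> x /=.
  by move=> BFk; exists (pickle (k x)) => //; rewrite pickleK; case: asboolP.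
by move=> [n _]; case: unpickle => // c; case: asboolP => // Bc /= ->.
Qed.

Lemma prob_mass_mix (R : realType) (T : choiceType) (eps : R) (p q : T -> R) :
  0 <= eps <= 1 -> prob_mass [set: T] p -> prob_mass [set: T] q ->
  prob_mass [set: T] (fun t => (1 - eps) * p t + eps * q t).
Proof.
move=> /andP[e0 e1] [p0 p1] [q0 q1].
have d0 : 0 <= 1 - eps by rewrite subr_ge0.
split=> [t _|]; first by rewrite addr_ge0// mulr_ge0// ?p0 ?q0.
under eq_esum do rewrite EFinD.
rewrite esumD; last 2 first.
- by move=> t _; rewrite lee_fin mulr_ge0// p0.
- by move=> t _; rewrite lee_fin mulr_ge0// q0.
rewrite !esumZl// => [|t|t]; rewrite ?p0 ?q0//.
by rewrite p1 q1 !mule1 -EFinD subrK.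
Qed.

Lemma prob_mass_dirac (R : realType) (T : choiceType) (t0 : T) :
  prob_mass [set: T] (fun t => (t == t0)%:R : R).
Proof.
split=> [t _|]; first exact: ler0n.
rewrite (esumID [set t0]); last by move=> t _; rewrite lee_fin.
rewrite setTI esum_set1 ?eqxx ?lee_fin// [X in (_ + X)%E]esum1 ?adde0//.
by move=> t [_ /= /eqP/negbTE ->].
Qed.

(** * Escape along infinite orbits *)
Section escape.
Variables (R : realType) (G : groupType) (d : measure_display).
Variables (X : measurableType d) (act : G -> X -> X) (e : nat -> G).
Variable A : nat -> set X.
Hypotheses (cG : countable [set: G]) (actP : is_action act).
Hypothesis mact : borel_action act.
Hypothesis eP : forall g, exists n, e n = g.
Hypothesis mA : forall n, measurable (A n).
Hypothesis A_inj : forall n n' x, A n x -> A n' x -> n = n'.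
Hypothesis A_hit : forall n x, infinite_set (orbit_of act x) ->
  exists g, A n (act g x).

(** Any law of full support would serve; the weights on levels are reused. *)
Let nu : G -> R := push_mass (@branch_mass R) (fun i => e i.1.-1).

Let nuP : prob_mass [set: G] nu.
Proof. exact/prob_mass_push_mass/branch_mass_prob. Qed.

Let nu_gt0 g : 0 < nu g.
Proof.
have [n <-] := eP g.
have := @push_mass_ge _ _ _ _ (fun i => e i.1.-1) (@branch_mass_prob R) (n.+1, false).
by apply: lt_le_trans; exact: branch_mass_gt0.
Qed.

Definition first_jump (n k : nat) : set X :=
  [set x | [/\ A n x, A n.+2 (act (e k) x)
    & forall i, (i < k)%N -> ~ A n.+2 (act (e i) x)]].

Lemma first_jump_inj n k n' k' x :
  first_jump n k x -> first_jump n' k' x -> (n, k) = (n', k').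
Proof.
move=> [An Ak lk] [An' Ak' lk']; have nn := A_inj An An'; subst n'.
congr (_, _); have [kk|kk|//] := ltngtP k k'.
  by have := lk' _ kk Ak.
by have := lk _ kk Ak'.
Qed.

Lemma measurable_first_jump n k : measurable (first_jump n k).
Proof.
have mpre g (C : set X) : measurable C -> measurable [set x | C (act g x)].
  by move=> mC; rewrite -[X in measurable X]setTI; exact: (measurable_act mact).
rewrite (_ : first_jump n k = A n `&` ([set x | A n.+2 (act (e k) x)] `&`
    \bigcap_(i in `I_k) ~` [set x | A n.+2 (act (e i) x)])).
  apply: measurableI => //; apply: measurableI; first exact: mpre.
  by apply: bigcap_measurableType => i _; apply: measurableC; exact: mpre.
by apply/seteqP; split=> x [h1 h2]; [split|case: h2 => h2 h3; split].
Qed.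

Definition jump (x : X) : option (nat * nat) :=
  xget None [set o | if o is Some (n, k) then first_jump n k x else False].

Lemma jumpE n k x : first_jump n k x -> jump x = Some (n, k).
Proof.
move=> J; rewrite /jump; case: xgetP => [[[n' k']|] _ //= J'|/(_ (Some (n, k)))//].
by rewrite (first_jump_inj J J').
Qed.

Lemma measurable_jump o : measurable [set x | jump x = o].
Proof.
have mJ n k : measurable [set x | jump x = Some (n, k)].
  rewrite (_ : [set x | _] = first_jump n k); first exact: measurable_first_jump.
  apply/seteqP; split=> x /=; last exact: jumpE.
  by rewrite /jump; case: xgetP => // -[[n' k']|] //= _ J [<- <-].
case: o => [[n k]|] //.
rewrite (_ : [set x | _] = ~` \bigcup_n \bigcup_k [set x | jump x = Some (n, k)]).
  apply: measurableC; apply: bigcupT_measurable => n.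
  exact: bigcupT_measurable.
apply/seteqP; split=> x /=; first by move=> j0 [n _ [k _ /=]]; rewrite j0.
by case E : (jump x) => [[n k]|] // no; exfalso; apply: no; exists n => //; exists k.
Qed.

(** From [x] the walk moves to the source [act h^-1 x] of the chosen arrow, so [h = (e k)^-1] leads
    to [act (e k) x]. Mixing in [nu] makes the operator non-degenerate in one step. *)
Definition escape_mass (o : option (nat * nat)) (h : G) : R :=
  if o is Some (n, k) then
    (1 - 2^-1 ^+ n.+1) * (h == (e k)^-1%g)%:R + 2^-1 ^+ n.+1 * nu h
  else nu h.

Let half n : 0 < (2^-1 : R) ^+ n <= 1.
Proof. by rewrite exprn_gt0 ?invr_gt0//= exprn_ile1// ?invr_ge0// invf_le1// ler1n. Qed.

Lemma escape_mass_prob o : prob_mass [set: G] (escape_mass o).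
Proof.
case: o => [[n k]|] //=; apply: prob_mass_mix => //; last exact: prob_mass_dirac.
by have /andP[/ltW -> ->] := half n.+1.
Qed.

Lemma escape_mass_gt0 o h : 0 < escape_mass o h.
Proof.
case: o => [[n k]|] //=; have /andP[h0 h1] := half n.+1.
by apply: ltr_wpDl; [rewrite mulr_ge0// subr_ge0|exact: mulr_gt0].
Qed.

Definition escape_op := markov_of (fun x => escape_mass (jump x)).

Lemma escape_invariant : invariant_markov act escape_op.
Proof.
apply: invariant_markov_of => // [x|h]; first exact: escape_mass_prob.
apply: (measurable_countable_factor (fun o => escape_mass o h)).
exact: measurable_jump.
Qed.

Lemma escape_nondegenerate : Defs.nondegenerate act escape_op.
Proof.
move=> x; apply/seteqP; split=> [a [n _ []]//|a ax].
by exists 0%N => //; split=> //=; rewrite lte_fin escape_mass_gt0.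
Qed.

(** A lower bound for the probability that the parity of the level is eventually [b]: from level n,
    the chances of failing at n, n + 2, ... add up to less than 2^-n. *)
Let deep (b : bool) (x : X) : R :=
  if `[< infinite_set (orbit_of act x) /\ exists n, A n x /\ odd n = b >]
  then 1 - 2^-1 ^+ xget 0%N [set n | A n x] else 0.

Let deepE b n x : infinite_set (orbit_of act x) -> A n x -> odd n = b ->
  deep b x = 1 - 2^-1 ^+ n.
Proof.
move=> infx An nb; rewrite /deep asboolT; last by split=> //; exists n.
congr (1 - _ ^+ _); case: xgetP => [m _ /= Am|/(_ n)//].
exact: A_inj Am An.
Qed.

Let deep_cases b x : deep b x = 0 \/ exists n, [/\ infinite_set (orbit_of act x), A n x,
  odd n = b & deep b x = 1 - 2^-1 ^+ n].
Proof.
rewrite /deep; case: asboolP => [[infx [n [An nb]]]|_]; [right|by left].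
exists n; split=> //; rewrite -(deepE infx An nb) /deep asboolT//.
by split=> //; exists n.
Qed.

Let deep01 b x : 0 <= deep b x <= 1.
Proof.
have [->|[n [_ _ _ ->]]] := deep_cases b x; first by rewrite lexx ler01.
by have /andP[? ?] := half n; apply/andP; split; lra.
Qed.

Let deep_sum x : deep true x + deep false x <= 1.
Proof.
have [->|[n [_ An nb _]]] := deep_cases true x.
  by rewrite add0r; case/andP: (deep01 false x).
have [->|[n' [_ An' nb' _]]] := deep_cases false x.
  by rewrite addr0; case/andP: (deep01 true x).
by move: nb; rewrite (A_inj An An') nb'.
Qed.

Let deep_subharmonic b x :
  deep b x <= avg (escape_mass (jump x)) (deep b \o (fun h => act h^-1%g x)).
Proof.
have bd : bnd (deep b \o (fun h => act h^-1%g x)) by apply: bnd01 => h; exact: deep01.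
have d0 h : 0 <= (deep b \o (fun h => act h^-1%g x)) h by case/andP: (deep01 b (act h^-1%g x)).
have [->|[n [infx An nb dE]]] := deep_cases b x.
  exact: (avg_ge0 (escape_mass_prob _)).
have [k [Ak kmin]] : exists k, A n.+2 (act (e k) x) /\
    forall i, (i < k)%N -> ~ A n.+2 (act (e i) x).
  have [g Ag] := A_hit n.+2 infx; have [m mg] := eP g; subst g.
  have [k /asboolP Ak kmin] := ex_minnP
    (ex_intro (fun k => `[< A n.+2 (act (e k) x) >]) m (asboolT Ag)).
  exists k; split=> // i ik Ai; have := kmin i (asboolT Ai).
  by rewrite leqNgt ik.
have jx : jump x = Some (n, k) by apply: jumpE.
apply: le_trans (avg_point (escape_mass_prob (jump x)) ((e k)^-1)%g d0 bd).
rewrite jx dE /= eqxx mulr1 invgK.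
have := @deepE b n.+2 (act (e k) x); rewrite orbit_of_act// => /(_ infx Ak) ->; last first.
  by rewrite /= negbK.
rewrite !exprS; have /andP[t0 t1] := half n; set t := _ ^+ n in t0 t1 *.
have nu0 : 0 <= 2^-1 * t * nu (e k)^-1%g by rewrite !mulr_ge0// ltW.
(* With t = 2^-n this is (1 - t / 2) (1 - t / 4) >= 1 - t. *)
apply: (@le_trans _ _ ((1 - 2^-1 * t) * (1 - 2^-1 * (2^-1 * t)))).
  have := mulr_ge0 (ltW t0) (ltW t0); lra.
apply: ler_wpM2r; last lra.
by have := mulr_ge0 (ltW t0) (ltW t0); lra.
Qed.

Lemma escape_liouville x : liouville act escape_op x -> finite_set (orbit_of act x).
Proof.
move=> lx; apply: contrapT => infx.
have [F [F01 uF Fv FQ]] := harmonic_between (w := fun x => escape_mass (jump x))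
  (nx := fun x h => act h^-1%g x) (fun x => escape_mass_prob (jump x))
  (fun x => proj1 (andP (deep01 true x))) (fun x => proj1 (andP (deep01 false x)))
  deep_sum (deep_subharmonic true) (deep_subharmonic false).
have [|[g y] _|c Fc] := lx (fun a => (F a.2)%:C%C).
- exists 1 => a _; rewrite norm_real_complex lecR.
  by have /andP[F0 F1] := F01 a.2; rewrite ger0_norm.
- rewrite markov_opE//= [in RHS]FQ -csum_avg_real; congr csum; apply/funext => h.
  by case: actP => _ aM; rewrite invgM aM actK.
(* [F] is at most 1 / 4 at level 2 and at least 7 / 8 at level 3. *)
have [g Ag] := A_hit 2 infx; have [h Ah] := A_hit 3 infx.
have := Fc (arrow act x g^-1%g) (arrow_fiber actP _ _).
rewrite -(Fc (arrow act x h^-1%g) (arrow_fiber actP _ _)) /= !invgK => -[Fgh].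
have := uF (act h x); have := Fv (act g x).
rewrite (@deepE true 3)// ?orbit_of_act// (@deepE false 2)// ?orbit_of_act// Fgh.
rewrite !exprS expr0; lra.
Qed.

End escape.

(** * From the groupoid to the group, and the equivalence *)

Lemma group_choquet_deny_of_groupoid (R : realType) (G : groupType)
    (d : measure_display) (X : measurableType d) (mu : probability X R)
    (act : G -> X -> X) :
  countable [set: G] -> is_action act -> borel_action act ->
  groupoid_choquet_deny mu act -> group_choquet_deny R G.
Proof.
move=> cG actP mact CD nu nuP gen f [M fM] hf.
pose P := markov_of (X := X) (fun=> nu).
have PI : invariant_markov act P.
  by apply: invariant_markov_of => // h; exact: measurable_cst.
have nu0 g : 0 <= nu g by case: nuP => nu0 _; exact: nu0.
have pow_ge0 n x a : (0 <= markov_pow act P n x a)%E.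
  elim: n x a => [|n IH] x a /=; first by rewrite lee_fin; exact: nu0.
  by apply: esum_ge0 => h _; apply: mule_ge0 => //; rewrite lee_fin; exact: nu0.
have powS n x k g : 0 < nu k ->
    (0 < markov_pow act P n (act k^-1%g x) (arrow act (act k^-1%g x) g))%E ->
    (0 < markov_pow act P n.+1 x (arrow act x (k * g)%g))%E.
  move=> k0 pos /=; apply: lt_le_trans (_ : (0 < (nu k)%:E * markov_pow act P n
    (act k^-1%g x) (arrow act (act k^-1%g x) g))%E) _; first exact: mule_gt0.
  apply: esum_ge; exists [set arrow act x k].
    by split=> // _ ->; exact: arrow_fiber.
  rewrite fsbig_set1 /gpd_mul /gpd_inv /source /arrow /= mulKg.
  by case: actP => _ aM; rewrite invgM aM.
(* Quantified over all [x], because in a product [g * h] the second factor is read over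
   [act g^-1 x]; this makes [pos] a semigroup containing the support of [nu]. *)
pose pos g := forall x, exists n, (0 < markov_pow act P n x (arrow act x g))%E.
have powV n x g : (0 < markov_pow act P n x (arrow act x g))%E -> forall h, pos h ->
    exists m, (0 < markov_pow act P m x (arrow act x (g * h)%g))%E.
  elim: n x g => [|n IH] x g.
    move=> g0 h hpos; have [m hm] := hpos (act g^-1%g x).
    by exists m.+1; apply: powS.
  move=> /= gpos h hpos; have [k [k0 kpos]] : exists k, 0 < nu k /\
      (0 < markov_pow act P n (act k^-1%g x) (arrow act (act k^-1%g x) (k^-1 * g)%g))%E.
    apply: contrapT => no; move: gpos; apply/negP; rewrite -leNgt.
    rewrite (reindex_esum _ _ _ _ (arrow_bij actP x)).
    rewrite esum1// => k _; have := nu0 k; rewrite le_eqVlt => /predU1P[k0|k0].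
      by have -> : P x (arrow act x k) = 0; rewrite ?mul0e.
    have := pow_ge0 n (act k^-1%g x) (arrow act (act k^-1%g x) (k^-1 * g)%g).
    rewrite le_eqVlt => /predU1P[|kpos]; last by case: no; exists k.
    rewrite /gpd_mul /gpd_inv /source /arrow /=.
    by case: actP => _ aM; rewrite invgM invgK -aM !gnorm => <-; rewrite mule0.
  have [m mpos] := IH _ _ kpos h hpos; exists m.+1.
  by have := powS m x k _ k0 mpos; rewrite !gnorm.
have PN : Defs.nondegenerate act P.
  move=> x; apply/seteqP; split=> [a [n _ []]//|a ax].
  have [n npos] : exists n, (0 < markov_pow act P n x (arrow act x a.1))%E.
    have : generated_semigroup [set g | 0 < nu g] a.1 by rewrite gen.
    move=> /(_ pos); apply=> //; split=> [g h gpos hpos y|g g0 y]; last by exists 0%N; rewrite /= lte_fin.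
    by have [m mpos] := gpos y; exact: powV mpos h hpos.
  by exists n => //; split=> //; rewrite (fiber_arrow actP ax).
(* Almost every fibre is Liouville and [mu] has mass 1, so one such fibre exists; [f] is then read
   on it through the group coordinate. *)
have [x lx] : exists x, liouville act P x.
  apply: contrapT => no; have [B [mB B0 sB]] := CD P PI PN.
  have BT : B = setT.
    apply/seteqP; split=> // x _; apply: sB => lx; apply: no; by exists x.
  by move: B0; rewrite BT probability_setT => -[] /eqP; rewrite oner_eq0.
have [|[g y] _|c Fc] := lx (fun a => f a.1).
- by exists M => a _; exact: fM.
- by rewrite markov_opE//= [in RHS]hf.
by exists c => g _; exact: (Fc (arrow act x g) (arrow_fiber actP x g)).
Qed.

Lemma negligible_sub (R : realType) (d : measure_display) (X : measurableType d)
    (mu : set X -> \bar R) (P Q : X -> Prop) : (forall x, P x -> Q x) ->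
  {ae mu, forall x, P x} -> {ae mu, forall x, Q x}.
Proof.
move=> PQ [B [mB B0 sB]]; exists B; split=> // x nQ; apply: sB => Px.
exact/nQ/PQ.
Qed.

Theorem theorem2p32 (R : realType) (G : groupType)
    (d : measure_display) (X : measurableType d) (mu : probability X R)
    (act : G -> X -> X) :
  countable [set: G] ->
  standard_borel R X ->
  is_action act -> borel_action act -> nonsingular mu act ->
  groupoid_choquet_deny mu act <->
  (group_choquet_deny R G /\ ae_finite_orbits mu act).
Proof.
move=> cG bX actP mact _; split=> [CD|[CD fin] P [Pmass _] Pnd].
  split; first exact: (group_choquet_deny_of_groupoid cG actP mact CD).
  have [e eP] := countable_enum (1%g : G) cG.
  have [U [mU sepU]] := standard_borel_separating bX.
  pose A := level act U.
  have mA n : measurable (A n).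
    by apply: (measurable_level (e := e)) => // g; exact: (measurable_act mact).
  have A_hit n x : infinite_set (orbit_of act x) -> exists g, A n (act g x).
    exact: level_hit.
  have A_inj n n' x : A n x -> A n' x -> n = n' by exact: level_inj.
  have := CD _ (escape_invariant R e cG actP mact mA A_inj)
    (escape_nondegenerate R act A eP).
  apply: negligible_sub => x; exact: escape_liouville.
apply: negligible_sub fin => x finx.
exact: liouville_finite_orbit (fc_closed_choquet_deny cG CD).
Qed.
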